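(* Let $\nu$ be a partition of $n$. The random-to-random shuffle acting on words of evaluation $\nu$ has an eigenvalue $\frac{1}{n^2}\operatorname{eig}(w)$ for each word $w$ of evaluation $\nu$, where $$\operatorname{eig}(w)=\Big[\tbinom{\ell(w)+1}{2}+\operatorname{diag}(Q(w))\Big]-\Big[\tbinom{\ell(w')+1}{2}+\operatorname{diag}(Q(w'))\Big]$$ and $w'$ is the longest suffix of $w$ whose first ascent is even. That is, the multiplicity of an eigenvalue $\varepsilon$ is the number of words $w$ of evaluation $\nu$ with $\operatorname{eig}(w)=n^2\varepsilon$.
   Context: Words are finite sequences over an ordered alphabet $\{1,2,\dots,N\}$; $\ell(w)$ is the length of $w$; $w$ has evaluation $\nu$ if it contains $\nu_i$ occurrences of letter $i$ for each $i$. The random-to-random shuffle on words of evaluation $\nu\vdash n$ is the Markov chain which removes the letter in a uniformly random position and reinserts it at a uniformly random one of the $n$ possible positions; its eigenvalues are those of its transition matrix. A position $i\in\{1,\dots,n\}$ of a word $w=w_1\cdots w_n$ is a (weak) ascent if $i=n$, or $i<n$ and $w_i\le w_{i+1}$. The suffix $w'$ may be the empty word (whose recording tableau is the empty tableau), which is taken when no nonempty suffix has even first ascent. $Q(w)$ is the recording tableau of $w$ under the Robinson–Schensted–Knuth correspondence (row insertion, where an inserted letter $i$ bumps the leftmost entry of the row strictly greater than $i$, or is appended if none exists; $Q(w)$ records in which step each cell was created). For a tableau $Q$ of shape $\lambda$, $\operatorname{diag}(Q)=\sum_{\text{cells }(i,j)\text{ of }\lambda}(j-i)$, using matrix coordinates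 for cells. *)

(* Defs.v *)
From HB Require Import structures.
From mathcomp Require Import all_boot all_order all_algebra.

Set Implicit Arguments.
Unset Strict Implicit.
Unset Printing Implicit Defensive.

Import Order.TTheory GRing.Theory Num.Theory.

Local Open Scope ring_scope.

Definition is_partition_of (nu : seq nat) (n : nat) : bool :=
  [&& sorted geq nu, 0%N \notin nu & sumn nu == n].

(* The letter i + 1 of the alphabet {1, ..., N} is encoded by i : 'I_N; letters
   beyond the length of the partition nu occur zero times. *)
Definition has_evaluation (N : nat) (nu : seq nat) (w : seq 'I_N) : bool :=
  [forall i : 'I_N, count_mem i w == nth 0%N nu i].

Definition word (N n : nat) (nu : seq nat) : Type :=
  {w : n.-tuple 'I_N | has_evaluation nu w}.

HB.instance Definition _ (N n : nat) (nu : seq nat) := SubFinite.on (word N n nu).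

Definition letters (N n : nat) (nu : seq nat) (w : word N n nu) : seq nat :=
  [seq nat_of_ord i | i <- tval (sval w)].

(* Positions i and j are counted from 0; after the removal, j ranges over the
   size s possible places for the reinsertion. *)
Definition move_letter (s : seq nat) (i j : nat) : seq nat :=
  let x := nth 0%N s i in
  let t := take i s ++ drop i.+1 s in
  take j t ++ x :: drop j t.

Definition r2r_prob (R : numFieldType) (N n : nat) (nu : seq nat)
    (u v : word N n nu) : R :=
  #|[set ij : 'I_n * 'I_n | move_letter (letters u) ij.1 ij.2 == letters v]|%:R
    / n%:R ^+ 2.

Definition r2r_matrix (R : numFieldType) (N n : nat) (nu : seq nat) :
    'M[R]_#|{: word N n nu}| :=
  \matrix_(i, j) r2r_prob R (enum_val i) (enum_val j).

(* Counted from 1. The last position is always an ascent; the empty word has no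
   ascent, and 0 is a dummy value for it. *)
Fixpoint first_ascent (s : seq nat) : nat :=
  match s with
  | [::] => 0
  | x :: s1 =>
      match s1 with
      | [::] => 1
      | y :: _ => if (x <= y)%N then 1 else (first_ascent s1).+1
      end
  end.

(* The longest suffix whose first ascent is even, the empty word if there is no
   nonempty one. *)
Fixpoint even_ascent_suffix (s : seq nat) : seq nat :=
  if s is _ :: s1 then
    if odd (first_ascent s) then even_ascent_suffix s1 else s
  else [::].

(* Tableaux are sequences of rows. The second component is the bumped entry. *)
Fixpoint row_insert (x : nat) (r : seq nat) : seq nat * option nat :=
  if r is y :: r1 then
    if (x < y)%N then (x :: r1, Some y)
    else let: (r2, b) := row_insert x r1 in (y :: r2, b)
  else ([:: x], None).

(* The second component is the index of the row in which a cell is created. *)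
Fixpoint tableau_insert (x : nat) (P : seq (seq nat)) : seq (seq nat) * nat :=
  if P is r :: P1 then
    let: (r1, b) := row_insert x r in
    if b is Some y then
      let: (P2, k) := tableau_insert y P1 in (r1 :: P2, k.+1)
    else (r1 :: P1, 0%N)
  else ([:: [:: x]], 0%N).

(* The new cell of the recording tableau Q receives the number of the current
   step, which is one more than the number of cells of Q. *)
Definition rsk_step (PQ : seq (seq nat) * seq (seq nat)) (x : nat) :
    seq (seq nat) * seq (seq nat) :=
  let: (P, Q) := PQ in
  let: (P1, k) := tableau_insert x P in
  (P1, set_nth [::] Q k (rcons (nth [::] Q k) (sumn (shape Q)).+1)).

Definition rsk (s : seq nat) : seq (seq nat) * seq (seq nat) :=
  foldl rsk_step ([::], [::]) s.

Definition recording_tableau (s : seq nat) : seq (seq nat) := (rsk s).2.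

Definition diag (Q : seq (seq nat)) : int :=
  \sum_(i < size Q) \sum_(j < size (nth [::] Q i)) (j%:Z - i%:Z).

Definition eig (s : seq nat) : int :=
  let s' := even_ascent_suffix s in
  ('C((size s).+1, 2)%:Z + diag (recording_tableau s))
    - ('C((size s').+1, 2)%:Z + diag (recording_tableau s')).

(* Main.v *)
From HB Require Import structures.
Require Import Defs.
From mathcomp Require Import all_boot all_order all_algebra.
From mathcomp Require Import fingroup perm.
From mathcomp Require Import mpoly ring zify.

(* Let S_a and D_a insert, resp. delete, a letter a in all possible ways, and let
   E_ba replace one b by an a in all possible ways. Then R = sum_b S_b D_b counts
   the moves of the shuffle, [D_b, S_a] = (n + 1) [a = b] + E_ba on words of length
   n, and the E_ba span an action of gl_N which commutes with R. Let C be n(n + 1)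
   plus twice the sum of the transpositions of positions; up to a scalar, this is
   the Casimir operator of gl_N. The operator C - 2 R commutes with every S_a.
   Hence the weighted traces of the powers of C - 2 R satisfy a recursion, by
   cyclicity of the trace and a trace form of Freudenthal's formula, which says
   that C acts on generating polynomials of traces as a Laplacian conjugated by
   the Weyl denominator.
   The sums of the powers of n'(n' + 1) + 2 diag(Q(w')), where n' is the length of
   w', satisfy the same recursion. Indeed, a word w factors uniquely as u w' with
   u weakly increasing; the shape of Q is invariant under the crystal operators,
   which commute with w |-> w' in a suitable sense; and on Yamanouchi words the
   shape is the weight, so that the tableaux also satisfy Freudenthal's formula.
   Therefore the trace of R ^ q on words of evaluation nu is the sum of the
   eig(w) ^ q. As R is symmetric, this determines its characteristic polynomial. *)

Set Implicit Arguments.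
Unset Strict Implicit.
Unset Printing Implicit Defensive.

Local Open Scope nat_scope.

(** * Bracketing and crystal operators *)

(** Why [C - 2 R]: moving [S_a] past [R] leaves the commutator [sum_b E_ba S_b + (n + 1) S_a], and
    moving it past [C] leaves exactly twice that. Thus [C - 2 R] is the combination whose spectrum
    is carried along by insertions, and the shorter word [w'] accounts for it. Since [C] and
    [C - 2 R] commute and [R] is half their difference, [eig] is a difference of two halves, with
    [n (n + 1) / 2] as the binomial coefficient. No eigenvector and no decomposition into
    irreducible modules is constructed. Only traces occur, graded by the content of words, hence as
    polynomials with one variable per letter. Powers of [R] require the mixed traces of
    [C ^ r (C - 2 R) ^ s]. Traces and tableau sums are compared after multiplication by the
    alternant of the staircase [delta], which can be cancelled because it is nonzero in an integral
    domain. On the tableau side the crystal operators replace representation theory: they make the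
    generating sums symmetric and reduce them, against this alternant, to Yamanouchi words. *)

(* Reading the letters i and i + 1 as closing and opening brackets, [brk i w] counts
   the unmatched i and the unmatched i + 1 of w. Unmatched i precede unmatched i + 1,
   which gives the product of such pairs. *)
Definition brk_mul (a b : nat * nat) : nat * nat :=
  (a.1 + (b.1 - a.2), b.2 + (a.2 - b.1)).

Definition brk_letter (i x : nat) : nat * nat :=
  (nat_of_bool (x == i), nat_of_bool (x == i.+1)).

Definition brk (i : nat) (w : seq nat) : nat * nat :=
  foldr (fun x a => brk_mul (brk_letter i x) a) (0, 0) w.

Arguments brk : simpl never.

Lemma brk_mulA : associative brk_mul.
Proof. by move=> [a b] [c d] [e f]; congr pair => /=; lia. Qed.

Lemma brk_mul0l a : brk_mul (0, 0) a = a.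
Proof. by case: a => a b; rewrite /brk_mul /=; congr pair; lia. Qed.

Lemma brk_mul0r a : brk_mul a (0, 0) = a.
Proof. by case: a => a b; rewrite /brk_mul /=; congr pair; lia. Qed.

Lemma brk_letter0 i x : (x < i) || (i.+1 < x) -> brk_letter i x = (0, 0).
Proof. by move=> xi; rewrite /brk_letter; congr pair; lia. Qed.

Lemma brk_letter1 i : brk_letter i i = (1, 0).
Proof. by rewrite /brk_letter; congr pair; lia. Qed.

Lemma brk_letter2 i : brk_letter i i.+1 = (0, 1).
Proof. by rewrite /brk_letter; congr pair; lia. Qed.

Lemma brk_seq1 i x : brk i [:: x] = brk_letter i x.
Proof. exact: brk_mul0r. Qed.

Lemma brk_cons i x w : brk i (x :: w) = brk_mul (brk_letter i x) (brk i w).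
Proof. by []. Qed.

Lemma brk_cat i u v : brk i (u ++ v) = brk_mul (brk i u) (brk i v).
Proof.
elim: u => [|x u IHu] /=; first by rewrite /brk; case: (foldr _ _ v) => a b; congr pair => /=; lia.
by rewrite !brk_cons IHu brk_mulA.
Qed.

Lemma brk_diff i w : (brk i w).1 + count_mem i.+1 w = (brk i w).2 + count_mem i w.
Proof. by elim: w => //= x w; case: (brk i w) => a b /=; lia. Qed.

Lemma brk_notin1 i w : i \notin w -> (brk i w).1 = 0.
Proof.
elim: w => //= x w IHw; rewrite inE negb_or => /andP[xi /IHw].
by case: (brk i w) => a b /=; move: xi; lia.
Qed.

Lemma brk_notin2 i w : i.+1 \notin w -> (brk i w).2 = 0.
Proof.
elim: w => //= x w IHw; rewrite inE negb_or => /andP[xi /IHw].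
by case: (brk i w) => a b /=; move: xi; lia.
Qed.

Lemma brk_notin i w : i \notin w -> i.+1 \notin w -> brk i w = (0, 0).
Proof.
by move=> /brk_notin1 + /brk_notin2; case: (brk i w) => a b /= -> ->.
Qed.

Lemma brk_gt i w : (forall z, z \in w -> i.+1 < z) -> brk i w = (0, 0).
Proof. by move=> w_gt; apply: brk_notin; apply/negP=> /w_gt; lia. Qed.

Lemma brk_lt i w : (forall z, z \in w -> z < i) -> brk i w = (0, 0).
Proof. by move=> w_lt; apply: brk_notin; apply/negP=> /w_lt; lia. Qed.

Lemma sorted_leq_cat (u v : seq nat) :
  sorted leq (u ++ v) =
  [&& sorted leq u, sorted leq v & allrel leq u v].
Proof.
by rewrite !(sorted_pairwise leq_trans) pairwise_cat andbC -andbA [X in _ && X]andbC.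
Qed.

Lemma sorted_leq_cons x (u : seq nat) :
  sorted leq (x :: u) = all (leq x) u && sorted leq u.
Proof. by rewrite !(sorted_pairwise leq_trans). Qed.

(** In a weakly increasing word no [i] follows an [i.+1], so every [i.+1] is unmatched. *)
Lemma brk_sorted2 i w : sorted leq w -> (brk i w).2 = 0 -> i.+1 \notin w.
Proof.
elim: w => //= x w IHw; rewrite -[path _ _ _]/(sorted leq (x :: w)) sorted_leq_cons.
case/andP=> /allP xw /IHw; rewrite inE negb_or.
have: x = i.+1 -> (brk i w).1 = 0.
  by move=> xi; apply: brk_notin1; apply/negP=> /xw; rewrite xi ltnn.
by case: (brk i w) => a b /=; lia.
Qed.

(* The raising operator, as a relation: the conditions say that the changed letter is
   the leftmost unmatched i + 1. *)
Definition crystal_step (i : nat) (w w' : seq nat) : Prop :=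
  exists A B, [/\ w = A ++ i.+1 :: B, w' = A ++ i :: B,
                  (brk i A).2 = 0 & (brk i B).1 = 0].

Definition crystal_eq (i : nat) (w w' : seq nat) : Prop :=
  w = w' \/ crystal_step i w w'.

(** Used to locate the letter changed by a crystal step with respect to a cut of the word. *)
Lemma cat_change (u u' v v' X Y : seq nat) c c' : size u = size u' ->
  u ++ v = X ++ c :: Y -> u' ++ v' = X ++ c' :: Y ->
  (exists B, [/\ u = X ++ c :: B, u' = X ++ c' :: B, v = v' & Y = B ++ v]) \/
  (exists B, [/\ u = u', v = B ++ c :: Y, v' = B ++ c' :: Y & X = u ++ B]).
Proof.
elim: u u' X => [|a u IHu] [|a' u'] [|b X] //= => [_ -> ->|_ -> ->|[szu]|[szu]].
- by right; exists [::].
- by right; exists (b :: X).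
- case=> -> Ev [-> Ev']; left; exists u; have /eqP := etrans Ev (esym Ev').
  by rewrite eqseq_cat // => /andP[/eqP Eu /eqP Evv]; split=> //; rewrite Eu.
- case=> -> Ev [-> Ev'].
  have [[B [-> -> -> ->]]|[B [-> -> -> ->]]] := IHu _ _ szu Ev Ev'.
    by left; exists B.
  by right; exists B.
Qed.

Variant row_insert_spec (x : nat) (r : seq nat) : seq nat * option nat -> Prop :=
| RowAppend of all (geq x) r : row_insert_spec x r (rcons r x, None)
| RowBump r1 y r2 of r = r1 ++ y :: r2 & all (geq x) r1 & x < y :
    row_insert_spec x r (r1 ++ x :: r2, Some y).

Lemma row_insertP x r : row_insert_spec x r (row_insert x r).
Proof.
elim: r => [|y r IHr] /=; first by constructor.
case: ltnP => xy; first exact: (@RowBump _ _ [::]).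
case: IHr => [r_le|r1 z r2 -> r1_le xz]; first by constructor; rewrite /= xy.
by apply: (@RowBump _ _ (y :: r1)) => //=; rewrite xy.
Qed.

Lemma row_insert_append x r : all (geq x) r -> row_insert x r = (rcons r x, None).
Proof.
by elim: r => //= y r IHr /andP[yx /IHr ->]; rewrite ltnNge yx.
Qed.

Lemma row_insert_bump x r1 y r2 : all (geq x) r1 -> x < y ->
  row_insert x (r1 ++ y :: r2) = (r1 ++ x :: r2, Some y).
Proof.
move=> + xy; elim: r1 => /= [|z r1 IHr]; first by rewrite xy.
by case/andP=> zx /IHr ->; rewrite ltnNge zx.
Qed.

Definition oseq (b : option nat) : seq nat := if b is Some y then [:: y] else [::].

Lemma row_insert_sorted x r : sorted leq r -> sorted leq (row_insert x r).1.
Proof.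
case: row_insertP => /= [r_le|r1 y r2 -> r1_le xy].
  rewrite -cats1 sorted_leq_cat => ->; rewrite /= allrel1r; exact: r_le.
rewrite !sorted_leq_cat !sorted_leq_cons !allrel_consr.
case/and3P=> -> /andP[/allP yr2 ->] /andP[_ ->]; rewrite r1_le !andbT /=.
by apply/allP=> z /yr2; lia.
Qed.

Lemma row_insert_size x r :
  size (row_insert x r).1 = size r + ~~ isSome (row_insert x r).2.
Proof.
case: row_insertP => /= [_|r1 y r2 -> _ _]; first by rewrite size_rcons addn1.
by rewrite !size_cat addn0.
Qed.

(** Inserting [x] into [r] turns the word [r x] into the bumped letter followed by the new row. This
    is a chain of Knuth moves, which keep the unmatched brackets. The delicate case is [x = i]
    bumping [i.+1]. *)
Lemma brk_row_insert i x r : sorted leq r ->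
  brk i (oseq (row_insert x r).2 ++ (row_insert x r).1) = brk i (rcons r x).
Proof.
case: row_insertP => //= r1 y r2 -> r1_le xy.
rewrite sorted_leq_cat sorted_leq_cons => /and3P[r1s /andP[/allP yr2 r2s] _].
have /allP {}r1_le := r1_le.
have r1i : (x < i) -> brk i r1 = (0, 0).
  by move=> xi; apply: brk_notin; apply/negP=> /r1_le; rewrite /=; lia.
have r1j : (x <= i) -> (brk i r1).2 = 0.
  by move=> xi; apply: brk_notin2; apply/negP=> /r1_le; rewrite /=; lia.
have r2i : (i <= x) -> (brk i r2).1 = 0.
  by move=> xi; apply: brk_notin1; apply/negP=> /yr2; rewrite /=; lia.
have r2j : (i < x) || (i.+1 < y) -> brk i r2 = (0, 0).
  by move=> xi; apply: brk_notin; apply/negP=> /yr2; rewrite /=; lia.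
rewrite -cats1 -catA /= -[_ :: r1 ++ _]/([:: y] ++ r1 ++ [:: x] ++ r2).
rewrite -[_ :: r2 ++ _]/([:: y] ++ r2 ++ [:: x]) !brk_cat !brk_seq1.
have [xi|ix|xi] := ltngtP x i.
- by rewrite r1i // (brk_letter0 (x := x)) ?brk_mul0l ?brk_mul0r ?xi.
- rewrite r2j ?ix // (brk_letter0 (x := y)) ?brk_mul0l ?brk_mul0r //; lia.
rewrite xi in r1j r2i r2j xy *; have [yi|yi] := ltnP i.+1 y.
  rewrite r2j ?yi ?orbT // (brk_letter0 (x := y)) ?brk_mul0l ?brk_mul0r //; lia.
have -> : y = i.+1 by lia.
rewrite brk_letter1 brk_letter2; move: (r1j (leqnn _)) (r2i (leqnn _)).
case: (brk i r1) => a1 b1; case: (brk i r2) => a2 b2 /= -> ->.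
by rewrite /brk_mul /=; congr pair; lia.
Qed.

Ltac catnorm := repeat rewrite /= -catA /=.

(** The changed letter lies in the left context, in the row, at the inserted letter or in the right
    context. In both contexts, [brk_row_insert] keeps the bracket conditions. Otherwise both
    insertions either append or bump from the same place, and a single changed letter remains. *)
Lemma crystal_row_insert i A A' r r' x x' C C' :
  sorted leq r -> sorted leq r' -> size A = size A' -> size r = size r' ->
  crystal_eq i (A ++ r ++ x :: C) (A' ++ r' ++ x' :: C') ->
  isSome (row_insert x r).2 = isSome (row_insert x' r').2 /\
  crystal_eq i (A ++ (oseq (row_insert x r).2 ++ (row_insert x r).1) ++ C)
    (A' ++ (oseq (row_insert x' r').2 ++ (row_insert x' r').1) ++ C').
Proof.
move=> r_s r'_s szA szr [/eqP|[X [Y [Ew Ew' X2 Y1]]]].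
  rewrite eqseq_cat // => /andP[/eqP-> /=].
  by rewrite eqseq_cat // => /andP[/eqP->] /eqP[-> ->]; split; [|left].
have [[B [-> -> /eqP Ev EY]]|[D [<- Ev Ev' EX]]] := cat_change szA Ew Ew'.
  move: Ev; rewrite eqseq_cat // => /andP[/eqP Er /eqP[Ex EC]].
  rewrite -Er -Ex -EC; split=> //; right.
  exists X, (B ++ (oseq (row_insert x r).2 ++ (row_insert x r).1) ++ C).
  split; rewrite -?catA //.
  rewrite [oseq _ ++ _]catA -Y1 EY -cat_rcons brk_cat [brk i (_ ++ C)]brk_cat brk_row_insert //.
  by rewrite -!brk_cat.
have [[B [Er Er' Ev1 EY]]|[B [<- Ev1 Ev1' EX']]] := cat_change szr Ev Ev'; last first.
  case: B Ev1 Ev1' EX' => [|b B] /= [-> ->] [-> ->] EX'.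
    (* The inserted [i.+1] is the leftmost unmatched one, and in a sorted row any [i.+1] would be
       unmatched. *)
    have r_j : i.+1 \notin r.
      apply: brk_sorted2 => //; move: X2; rewrite EX EX' cats0 brk_cat /=.
      by rewrite /brk_mul /=; lia.
    have [r_le|r1 y r2 Er r1_le jy] := row_insertP i.+1 r.
      rewrite row_insert_append //=; last first.
        apply/allP=> z zr; have /= := allP r_le z zr.
        by rewrite leq_eqVlt => /orP[/eqP zj|//]; rewrite -zj zr in r_j.
      split=> //; right; exists (A ++ r), Y; split=> //; last by rewrite -X2 EX EX' cats0.
        by rewrite -cats1; catnorm.
      by rewrite -cats1; catnorm.
    have -> : row_insert i r = (r1 ++ i :: r2, Some y).
      rewrite Er row_insert_bump //; last by apply: ltn_trans jy.
      apply/allP=> z zr; have /= := allP r1_le z zr.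
      rewrite leq_eqVlt => /orP[/eqP zj|//].
      by rewrite -zj Er mem_cat zr in r_j.
    have r2_j z : z \in r2 -> i.+1 < z.
      move: r_s; rewrite Er sorted_leq_cat sorted_leq_cons => /and3P[_ /andP[/allP yr2 _] _].
      by move=> /yr2; apply: leq_trans.
    split=> //; right; exists (A ++ y :: r1), (r2 ++ Y); split; try by catnorm.
    - rewrite -X2 EX EX' cats0 Er !(brk_cat, brk_cons) (brk_letter0 (x := y)) ?jy ?orbT //.
      by rewrite (brk_gt r2_j) ?brk_mul0l ?brk_mul0r.
    - by rewrite brk_cat (brk_gt r2_j) brk_mul0l.
  split=> //; right; rewrite EX EX' in X2.
  exists (A ++ (oseq (row_insert b r).2 ++ (row_insert b r).1) ++ B), Y.
  split=> //; try by catnorm.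
  rewrite -X2 -cat_rcons brk_cat [brk i (_ ++ B)]brk_cat brk_row_insert //.
  by rewrite -!brk_cat.
rewrite {}EX {}EY in X2 Y1 *.
case: Ev1 => <- <- {x' C' Ev Ev' Ew Ew' szr szA}.
rewrite {}Er in r_s *; rewrite {}Er' in r'_s *.
move: r_s r'_s; rewrite !sorted_leq_cat !sorted_leq_cons !allrel_consr.
case/and3P=> D_s /andP[/allP Bj B_s] _ /and3P[_ _ /andP[/allP Di _]].
have [xi|ix|xi] := ltngtP x i.
- have xj : x < i.+1 by apply: ltnW.
  case: (row_insertP x D) => [D_le|s1 y s2 ED s1_le xy].
    rewrite !row_insert_bump //=; split=> //; right.
    exists A, (D ++ x :: B ++ C); split; try by catnorm.
      rewrite -X2 brk_cat [brk i D]brk_lt ?brk_mul0r // => z /(allP D_le) /=; lia.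
    rewrite -Y1 !(brk_cat, brk_cons) (brk_letter0 (x := x)) ?xi // !brk_mul0l.
    by rewrite [brk i D]brk_lt ?brk_mul0l // => z /(allP D_le) /=; lia.
  rewrite ED -!catA !cat_cons !row_insert_bump //=; split=> //; right.
  exists (A ++ y :: s1 ++ x :: s2), (B ++ C); split; try by catnorm.
    rewrite -X2 ED !(brk_cat, brk_cons) (brk_letter0 (x := x)) ?xi // !brk_mul0l.
    by rewrite [brk i s1]brk_lt ?brk_mul0l // => z /(allP s1_le) /=; lia.
  by rewrite -Y1 !(brk_cat, brk_cons) (brk_letter0 (x := x)) ?xi // brk_mul0l.
- have Dx : all (geq x) (rcons D i.+1).
    rewrite all_rcons /= ix; apply/allP=> z /Di /=; lia.
  have Dx' : all (geq x) (rcons D i).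
    rewrite all_rcons /= ltnW //; apply/allP=> z /Di /=; lia.
  case: (row_insertP x B) => [B_le|t1 y t2 EB t1_le xy].
    rewrite !row_insert_append -?cat_rcons ?all_cat ?Dx ?Dx' //=; split=> //; right.
    exists (A ++ D), (B ++ x :: C); split=> //.
      by rewrite -!cats1; catnorm.
    by rewrite -!cats1; catnorm.
  rewrite EB -(cat_rcons i.+1) -(cat_rcons i) (catA (rcons D i)) (catA (rcons D i.+1)).
  rewrite !row_insert_bump ?all_cat ?Dx ?Dx' //.
  split=> //; right.
  exists (A ++ y :: D), (t1 ++ x :: t2 ++ C); split; rewrite -?cats1; try by catnorm.
    by rewrite -X2 !(brk_cat, brk_cons) (brk_letter0 (x := y)) ?brk_mul0l //; lia.
  rewrite -Y1 EB !(brk_cat, brk_cons) (brk_letter0 (x := y)) ?brk_mul0l; last lia.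
  rewrite [brk i t2]brk_gt ?brk_mul0l ?brk_mul0r // => z zt2.
  move: B_s; rewrite EB sorted_leq_cat sorted_leq_cons => /and3P[_ /andP[/allP yt _] _].
  by have := yt z zt2; lia.
rewrite {}xi in Y1 *.
have Bi : i \notin B by apply/negP=> /Bj; lia.
case: B => [|b B] in B_s Bj Bi Y1 *.
  by move: Y1; rewrite cat0s brk_cons brk_letter1; case: (brk i C).
(* If [b] exceeded [i.+1], so would all of [B], and the inserted [i] would be an unmatched [i] to
   the right of the changed letter. *)
have bj : b = i.+1.
  apply/eqP; rewrite eq_sym eqn_leq Bj ?mem_head //= leqNgt; apply/negP=> jb.
  move: Y1; rewrite cat_cons -cat_rcons brk_cons (brk_letter0 (x := b)) ?jb ?orbT // brk_mul0l.
  rewrite -cats1 !brk_cat brk_seq1 brk_letter1 brk_gt.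
    by case: (brk i C).
  by move=> z zB; move: B_s; rewrite sorted_leq_cons => /andP[/allP/(_ z zB) + _]; lia.
rewrite {}bj in Y1 B_s Bj Bi *.
have D_le : all (geq i) D by apply/allP=> z /Di.
rewrite row_insert_bump // -cat_rcons row_insert_bump //=; last first.
  by rewrite all_rcons /= leqnn.
(* Both insertions bump an [i.+1], but from adjacent cells; the changed letter is now the one in the
   second of these cells. *)
split=> //; right; exists (A ++ i.+1 :: rcons D i), (B ++ C).
rewrite -cats1; split; try by catnorm.
- have D2 : (brk i D).2 = 0.
    by apply: brk_notin2; apply/negP=> /(allP D_le) /=; rewrite ltnn.
  rewrite !(brk_cat, brk_cons) -[brk i [::]]/(0, 0) brk_letter1 brk_letter2.
  move: X2 D2; rewrite brk_cat.
  by case: (brk i A) => a1 b1; case: (brk i D) => a2 b2; rewrite /brk_mul /=; lia.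
- have B1 : (brk i B).1 = 0.
    by apply: brk_notin1; move: Bi; rewrite inE negb_or => /andP[].
  move: Y1 B1; rewrite cat_cons !(brk_cat, brk_cons) brk_letter1 brk_letter2.
  by case: (brk i B) => a1 b1; case: (brk i C) => a2 b2; rewrite /brk_mul /=; lia.
Qed.

(** * Insertion tableaux *)

Definition reading (P : seq (seq nat)) : seq nat := flatten (rev P).

Lemma reading_cons r P : reading (r :: P) = reading P ++ r.
Proof. by rewrite /reading rev_cons flatten_rcons. Qed.

Lemma size_reading P : size (reading P) = sumn (shape P).
Proof. by elim: P => //= r P IHP; rewrite reading_cons size_cat IHP addnC. Qed.

Lemma tableau_insert_cons x r P :
  tableau_insert x (r :: P) =
  if (row_insert x r).2 is Some y then
    ((row_insert x r).1 :: (tableau_insert y P).1, (tableau_insert y P).2.+1)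
  else ((row_insert x r).1 :: P, 0).
Proof.
rewrite /=; case: (row_insert x r) => q [y|] //=.
by case: (tableau_insert y P).
Qed.

(** A bumped letter stands in the word just left of its row, which is where the insertion into the
    next row expects it. The context [C] absorbs the rows already passed, so that each bump is an
    instance of the row case. *)
Lemma crystal_tableau_insert i P P' x x' C C' :
  all (sorted leq) P -> all (sorted leq) P' -> shape P = shape P' ->
  crystal_eq i (reading P ++ x :: C) (reading P' ++ x' :: C') ->
  (tableau_insert x P).2 = (tableau_insert x' P').2 /\
  crystal_eq i (reading (tableau_insert x P).1 ++ C)
               (reading (tableau_insert x' P').1 ++ C').
Proof.
elim: P P' x x' C C' => [|r P IHP] [|r' P'] x x' C C' //.
rewrite !tableau_insert_cons !reading_cons -!catA.
move=> /andP[r_s P_s] /andP[r'_s P'_s] [szr shP] E.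
have szP : size (reading P) = size (reading P') by rewrite !size_reading shP.
have [] := crystal_row_insert r_s r'_s szP szr E.
case: (row_insert x r) => q [y|]; case: (row_insert x' r') => q' [y'|] //= _ {}E.
  by rewrite !reading_cons -!catA; have [-> ?] := IHP _ _ _ _ _ P_s P'_s shP E.
by rewrite !reading_cons -!catA.
Qed.

Lemma tableau_insert_sorted x P :
  all (sorted leq) P -> all (sorted leq) (tableau_insert x P).1.
Proof.
elim: P x => // r P IHP x /andP[r_s P_s]; rewrite tableau_insert_cons.
have := row_insert_sorted x r_s; case: (row_insert x r) => q [y|] /= -> //=.
exact: IHP.
Qed.

Lemma shape_tableau_insert x P :
  shape (tableau_insert x P).1 = incr_nth (shape P) (tableau_insert x P).2.
Proof.
elim: P x => // r P IHP x; rewrite tableau_insert_cons.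
have := row_insert_size x r; case: (row_insert x r) => q [y|] /= -> //=.
  by rewrite addn0 IHP.
by rewrite addn1.
Qed.

Lemma tableau_insert_index x P : (tableau_insert x P).2 <= size P.
Proof.
elim: P x => // r P IHP x; rewrite tableau_insert_cons.
by case: (row_insert x r) => q [y|] //=; apply: IHP.
Qed.

Lemma brk_tableau_insert i x P : all (sorted leq) P ->
  brk i (reading (tableau_insert x P).1) = brk i (rcons (reading P) x).
Proof.
elim: P x => // r P IHP x /andP[r_s P_s]; rewrite tableau_insert_cons.
have := brk_row_insert i x r_s; case: (row_insert x r) => q [y|] /= Eq.
  rewrite !reading_cons brk_cat IHP // -cats1 brk_cat -brk_mulA -brk_cat Eq.
  by rewrite -brk_cat rcons_cat.
by rewrite !reading_cons brk_cat Eq -brk_cat rcons_cat.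
Qed.

Lemma perm_row_insert x r :
  perm_eq (oseq (row_insert x r).2 ++ (row_insert x r).1) (x :: r).
Proof.
case: row_insertP => /= [_|r1 y r2 -> _ _]; first by rewrite perm_rcons.
by apply/seq.permP=> a; rewrite /= !count_cat /=; lia.
Qed.

Lemma perm_tableau_insert x P :
  perm_eq (reading (tableau_insert x P).1) (x :: reading P).
Proof.
elim: P x => // r P IHP x; rewrite tableau_insert_cons.
have := perm_row_insert x r; case: (row_insert x r) => q [y|] /= /seq.permP Eq;
  rewrite !reading_cons; apply/seq.permP=> a; move: (Eq a); rewrite /= !count_cat.
  by rewrite (seq.permP (IHP y)) /=; lia.
by lia.
Qed.

(** The consequence of column-strictness that identifies the tableau of a Yamanouchi word: the
    entries of a row are bounded below by its index. *)
Fixpoint rows_ge (k : nat) (P : seq (seq nat)) : bool :=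
  if P is r :: P1 then all (leq k) r && rows_ge k.+1 P1 else true.

Lemma rows_ge_insert k x P : k <= x -> rows_ge k P -> rows_ge k (tableau_insert x P).1.
Proof.
elim: P k x => [|r P IHP] k x kx; first by rewrite /= kx.
rewrite tableau_insert_cons => /= /andP[kr kP].
case: row_insertP => [_|r1 y r2 Er _ xy] /=; first by rewrite all_rcons kx kr.
rewrite IHP ?(leq_ltn_trans kx) // andbT.
by move: kr; rewrite Er !all_cat /= kx => /and3P[-> _ ->].
Qed.

Definition insertion_tableau (s : seq nat) : seq (seq nat) := (rsk s).1.

Lemma rsk_rcons s x :
  rsk (rcons s x) =
  ((tableau_insert x (insertion_tableau s)).1,
   set_nth [::] (recording_tableau s) (tableau_insert x (insertion_tableau s)).2
     (rcons (nth [::] (recording_tableau s) (tableau_insert x (insertion_tableau s)).2)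
        (sumn (shape (recording_tableau s))).+1)).
Proof.
rewrite /insertion_tableau /recording_tableau {1}/rsk foldl_rcons -/(rsk s).
by rewrite /rsk_step; case: (rsk s) => P Q /=; case: (tableau_insert x P).
Qed.

Lemma insertion_tableau_rcons s x :
  insertion_tableau (rcons s x) = (tableau_insert x (insertion_tableau s)).1.
Proof. by rewrite {1}/insertion_tableau rsk_rcons. Qed.

Lemma shape_set_nth_rcons (Q : seq (seq nat)) k y : k <= size Q ->
  shape (set_nth [::] Q k (rcons (nth [::] Q k) y)) = incr_nth (shape Q) k.
Proof.
elim: Q k => [|r Q IHQ] [|k] //= kQ; first by rewrite size_rcons.
by rewrite -IHQ.
Qed.

Lemma shape_recording s : shape (recording_tableau s) = shape (insertion_tableau s).
Proof.
elim/last_ind: s => // s x IHs.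
rewrite insertion_tableau_rcons shape_tableau_insert /recording_tableau rsk_rcons /=.
rewrite shape_set_nth_rcons ?IHs //.
by have := congr1 size IHs; rewrite !size_map => ->; apply: tableau_insert_index.
Qed.

Lemma insertion_tableau_sorted s : all (sorted leq) (insertion_tableau s).
Proof.
elim/last_ind: s => // s x IHs; rewrite insertion_tableau_rcons.
exact: tableau_insert_sorted.
Qed.

Lemma insertion_tableau_rows_ge s : rows_ge 0 (insertion_tableau s).
Proof.
elim/last_ind: s => // s x IHs; rewrite insertion_tableau_rcons.
exact: rows_ge_insert.
Qed.

Lemma brk_insertion_tableau i s : brk i (reading (insertion_tableau s)) = brk i s.
Proof.
elim/last_ind: s => // s x IHs; rewrite insertion_tableau_rcons.
by rewrite brk_tableau_insert ?insertion_tableau_sorted // -!cats1 !brk_cat IHs.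
Qed.

Lemma perm_insertion_tableau s : perm_eq (reading (insertion_tableau s)) s.
Proof.
elim/last_ind: s => // s x IHs; rewrite insertion_tableau_rcons.
apply: perm_trans (perm_tableau_insert _ _) _.
by rewrite perm_sym perm_rcons perm_cons perm_sym.
Qed.

Lemma shape_crystal_cat i u u' C C' : size u = size u' ->
  crystal_eq i (u ++ C) (u' ++ C') ->
  shape (insertion_tableau u) = shape (insertion_tableau u') /\
  crystal_eq i (reading (insertion_tableau u) ++ C) (reading (insertion_tableau u') ++ C').
Proof.
elim/last_ind: u u' C C' => [|u x IHu] u' C C'.
  by case: u' => //= _ E.
case/lastP: u' => [|u' x']; first by rewrite size_rcons.
rewrite !size_rcons !cat_rcons => -[szu] E.
have [sh {}E] := IHu _ _ _ szu E.
have [Ek {}E] := crystal_tableau_insert (insertion_tableau_sorted u)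
  (insertion_tableau_sorted u') sh E.
by rewrite !insertion_tableau_rcons !shape_tableau_insert sh Ek.
Qed.

Lemma crystal_step_size i w w' : crystal_step i w w' -> size w = size w'.
Proof. by case=> A [B [-> -> _ _]]; rewrite !size_cat. Qed.

(* Row insertion commutes with the crystal operators, letter by letter. *)
Lemma shape_crystal_step i w w' : crystal_step i w w' ->
  shape (recording_tableau w) = shape (recording_tableau w').
Proof.
move=> E; have szw := crystal_step_size E; rewrite !shape_recording.
have {}E : crystal_eq i (w ++ [::]) (w' ++ [::]) by rewrite !cats0; right.
by have [] := shape_crystal_cat szw E.
Qed.

Lemma brk_suffix2 i u v : (brk i (u ++ v)).2 = 0 -> (brk i v).2 = 0.
Proof.
by rewrite brk_cat; case: (brk i u) => a b; case: (brk i v) => c d; rewrite /brk_mul /=; lia.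
Qed.

(** A letter [z.+1 > k] in the first row would be unmatched: the row is sorted, and the letters of
    [Z], coming from the rows above, are smaller than [k] and cannot match it. Hence the row is
    constant, and it joins [Z] for the next one. *)
Lemma yam_rows k P Z : all (sorted leq) P -> rows_ge k P -> all (ltn^~ k) Z ->
  (forall i, (brk i (reading P ++ Z)).2 = 0) ->
  forall j, all (pred1 (k + j)) (nth [::] P j).
Proof.
elim: P k Z => [|r P IHP] k Z; first by move=> _ _ _ _ j; rewrite nth_nil.
move=> /= /andP[r_s P_s] /andP[/allP kr kP] /allP Zk yamP.
have rk : all (pred1 k) r.
  apply/allP=> z zr /=; have := kr z zr; rewrite leq_eqVlt => /predU1P[-> //|kz].
  case: z => // z in zr kz *; rewrite ltnS in kz.
  have : (brk z r).2 = 0.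
    have := yamP z; rewrite reading_cons -catA => /brk_suffix2; rewrite brk_cat.
    rewrite [brk z Z](@brk_lt z) ?brk_mul0r // => y /Zk /=; lia.
  by move/(brk_sorted2 r_s); rewrite zr.
move=> [|j]; first by rewrite addn0.
rewrite addnS -addSn; apply: (IHP k.+1 (r ++ Z)) => //.
  rewrite all_cat; apply/andP; split; apply/allP=> z /=; first by move/(allP rk)/eqP->.
  by move/Zk => /=; lia.
by move=> i; have := yamP i; rewrite reading_cons -catA.
Qed.

Lemma count_reading_rows k P j : (forall m, all (pred1 (k + m)) (nth [::] P m)) ->
  count_mem j (reading P) = if k <= j then size (nth [::] P (j - k)) else 0.
Proof.
elim: P k => [|r P IHP] k rows; first by rewrite nth_nil; case: ifP.
rewrite reading_cons count_cat (IHP k.+1); last first.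
  by move=> m; have := rows m.+1; rewrite addnS addSn.
have := rows 0; rewrite /= addn0 => /all_pred1P ->; rewrite count_nseq /=.
case: ltngtP => [kj|jk|->]; rewrite ?mul0n ?addn0 //=.
- by have -> : j - k = (j - k.+1).+1 by lia.
- by rewrite subnn add0n mul1n /= size_nseq.
Qed.

Local Open Scope ring_scope.
Import GRing.Theory Num.Theory Order.TTheory.

Lemma diag_shape (Q Q' : seq (seq nat)) : shape Q = shape Q' -> diag Q = diag Q'.
Proof.
move=> shE; rewrite /diag.
have -> : size Q = size Q' by have := congr1 size shE; rewrite !size_map.
apply: eq_bigr => i _.
have szE : size (nth [::] Q i) = size (nth [::] Q' i).
  have := congr1 (fun s => nth 0%N s i) shE.
  have nthE (S : seq (seq nat)) : nth 0%N (shape S) i = size (nth [::] S i).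
    by elim: S (nat_of_ord i) => [|r S IHS] [|k] //=; rewrite ?nth_nil.
  by rewrite !nthE.
by rewrite szE.
Qed.

Lemma sum_row (m i : nat) :
  (\sum_(j < m) (j%:Z - i%:Z)) *+ 2 = m%:Z * (m%:Z - 1) - m%:Z * i%:Z *+ 2.
Proof.
elim: m => [|m IHm]; first by rewrite big_ord0 mul0rn !mul0r.
by rewrite big_ord_recr /= mulrnDl IHm intS; ring.
Qed.

Lemma yam_diag (N : nat) (w : seq nat) : all (ltn^~ N) w ->
  (forall i, (brk i w).2 = 0%N) ->
  diag (recording_tableau w) *+ 2 =
  \sum_(i < N) ((count_mem (i : nat) w)%:Z * ((count_mem (i : nat) w)%:Z - 1)
     - (count_mem (i : nat) w)%:Z * i%:Z *+ 2).
Proof.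
move=> wN yamw; rewrite (diag_shape (shape_recording w)).
set P := insertion_tableau w.
have rows : forall m, all (pred1 m) (nth [::] P m).
  apply: (@yam_rows 0 P [::]) => //; first exact: insertion_tableau_sorted.
    exact: insertion_tableau_rows_ge.
  by move=> i; rewrite cats0 brk_insertion_tableau.
have cnt (j : nat) : count_mem j w = size (nth [::] P j).
  by rewrite -(seq.permP (perm_insertion_tableau w)) (@count_reading_rows 0) // subn0.
pose F (m i : nat) : int := m%:Z * (m%:Z - 1) - m%:Z * i%:Z *+ 2.
rewrite /diag -sumrMnl (eq_bigr (fun i : 'I_(size P) => F (size (nth [::] P i)) i)); last first.
  by move=> i _; apply: sum_row.
rewrite [RHS](eq_bigr (fun i : 'I_N => F (size (nth [::] P i)) i)); last first.
  by move=> i _; rewrite cnt.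
pose M := maxn (size P) N.
have F0 (i : nat) : (size P <= i)%N || (N <= i)%N -> F (size (nth [::] P i)) i = 0.
  move=> Pi; suff -> : nth [::] P i = [::] by rewrite /F /= !mul0r.
  case/orP: Pi => Pi; first by rewrite nth_default.
  apply/eqP; rewrite -size_eq0 -cnt; apply/eqP/count_memPn/negP.
  by move/(allP wN) => /=; rewrite ltnNge Pi.
rewrite -(big_mkord xpredT (fun i => F (size (nth [::] P i)) i)).
rewrite -(big_mkord xpredT (fun i => F (size (nth [::] P i)) i)).
rewrite (big_nat_widen _ _ M) ?leq_maxl // (big_nat_widen _ N M) ?leq_maxr //.
rewrite big_mkcond [RHS]big_mkcond; apply: eq_bigr => i _ /=.
by case: ltnP => iP; case: ltnP => iN //; rewrite F0 ?iP ?iN ?orbT.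
Qed.

(** * Descents and sums over words *)

Local Open Scope nat_scope.

Lemma first_ascent_cons x y s :
  first_ascent (x :: y :: s) = if x <= y then 1 else (first_ascent (y :: s)).+1.
Proof. by []. Qed.

(** Lowering the letter affects a comparison only with a left neighbour [i.+1] or a right neighbour
    [i]. The defaults of [last] and [head] make both conditions true at the ends of the word. *)
Lemma first_ascent_change i A B : last i A != i.+1 -> head i.+1 B != i ->
  first_ascent (A ++ i.+1 :: B) = first_ascent (A ++ i :: B).
Proof.
move=> A_last B_head.
have E0 : first_ascent (i.+1 :: B) = first_ascent (i :: B).
  by case: B B_head => // b B /= bi; rewrite [i <= b]leq_eqVlt eq_sym (negPf bi).
elim: A A_last {B_head} => [|a A IHA] A_last //.
case: A IHA A_last => [|a1 A] IHA A_last.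
  by rewrite !cat_cons !first_ascent_cons E0 [a <= i.+1]leq_eqVlt (negPf A_last).
rewrite !cat_cons !first_ascent_cons; case: ifP => // _.
by rewrite -!cat_cons IHA.
Qed.

Lemma brk_last i A : (brk i A).2 = 0 -> last i A != i.+1.
Proof.
case/lastP: A => [|A a]; first by rewrite /= neq_ltn ltnSn.
by rewrite -cats1 => /brk_suffix2; rewrite brk_seq1 last_cat /=; case: eqP => // ->; rewrite brk_letter2.
Qed.

Lemma brk_head i B : (brk i B).1 = 0 -> head i.+1 B != i.
Proof.
case: B => [|b B]; first by rewrite /= neq_ltn ltnSn orbT.
by rewrite brk_cons /= /brk_mul /=; lia.
Qed.

Lemma first_ascent_crystal_step i w w' : crystal_step i w w' ->
  first_ascent w = first_ascent w'.
Proof.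
case=> A [B [-> -> /brk_last A2 /brk_head B1]].
exact: first_ascent_change.
Qed.

Lemma even_ascent_suffix_cons x s :
  even_ascent_suffix (x :: s) =
  if odd (first_ascent (x :: s)) then even_ascent_suffix s else x :: s.
Proof. by []. Qed.

(** The suffixes that contain the changed letter keep their first ascent, and the bracket condition
    on [A] passes to its suffixes. The selected suffix thus either contains the change in both words
    or lies beyond it. *)
Lemma even_ascent_suffix_crystal_step i w w' : crystal_step i w w' ->
  even_ascent_suffix w = even_ascent_suffix w' \/
  crystal_step i (even_ascent_suffix w) (even_ascent_suffix w').
Proof.
case=> A [B [-> -> A2 B1]].
elim: A A2 => [|a A IHA] A2.
  rewrite !cat0s !even_ascent_suffix_cons.
  rewrite (@first_ascent_change i [::]) ?brk_head //=; last by rewrite neq_ltn ltnSn.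
  by case: ifP => _; [left | right; exists [::], B].
rewrite !cat_cons !even_ascent_suffix_cons -!cat_cons.
rewrite (@first_ascent_change i (a :: A)) ?brk_head ?brk_last //.
case: ifP => _; first exact/IHA/(@brk_suffix2 i [:: a]).
by right; exists (a :: A), B.
Qed.

(** Desarrangement words in the sense of Désarménien. The dummy value 0 of [first_ascent] makes the
    empty word one of them. *)
Definition desarrangement (s : seq nat) : bool := ~~ odd (first_ascent s).

Lemma even_ascent_suffix_id s : desarrangement s -> even_ascent_suffix s = s.
Proof. by case: s => // x s; rewrite even_ascent_suffix_cons => /negPf ->. Qed.

Lemma even_ascent_suffix_cat u v : sorted leq u -> desarrangement v ->
  even_ascent_suffix (u ++ v) = v.
Proof.
move=> + dv; elim: u => [|x u IHu] us; first exact: even_ascent_suffix_id.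
rewrite cat_cons even_ascent_suffix_cons IHu ?(path_sorted us) //.
suff -> : odd (first_ascent (x :: u ++ v)) by [].
case: u us {IHu} => [|y u] /=; last by case/andP=> ->.
by move=> _; case: v dv => //= y v; case: ifP => // _; rewrite oddS.
Qed.

(** Existence and uniqueness of the factorization, as a count of admissible cuts that can be
    exchanged with other sums. In front of [y :: w], a letter [x <= y] only prolongs the increasing
    part. A letter [x > y] flips the parity of the first ascent, which leaves exactly one of the
    cuts 0 and 1. *)
Lemma sorted_desarrangement_split w :
  \sum_(m < (size w).+1) (sorted leq (take m w) && desarrangement (drop m w)) = 1.
Proof.
elim: w => [|x w IHw]; first by rewrite big_ord1.
rewrite big_ord_recl /=.
have [Dw|Dw] := boolP (desarrangement (x :: w)).
  rewrite big1 // => m _; case: w Dw {IHw} m => // y w.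
  rewrite /desarrangement first_ascent_cons; case: leqP => //= xy.
  rewrite negbK => Ow [[|m] ltm] /=; first by rewrite Ow.
  by rewrite leqNgt xy.
rewrite add0n; case: w Dw IHw => [|y w]; first by rewrite big_ord1.
rewrite /desarrangement first_ascent_cons; case: leqP => [xy _ <-|yx].
  apply: eq_bigr => -[[|m] ltm] _ //=; first by rewrite xy.
rewrite oddS negbK => Dw _; rewrite big_ord_recl /= Dw big1 // => m _.
by rewrite /= leqNgt yx.
Qed.

(** * Words over a finite alphabet and the crystal bijections between them *)

Section Words.
Variable N : nat.

Fixpoint words (n : nat) : seq (seq nat) :=
  if n is n1.+1 then [seq a :: w | a <- iota 0 N, w <- words n1] else [:: [::]].

Lemma mem_words n w : (w \in words n) = (size w == n) && all (ltn^~ N) w.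
Proof.
elim: n w => [|n IHn] [|x w] //=.
  by apply/negP=> /allpairsP[[a v] /= []].
rewrite eqSS andbCA -IHn; apply/allpairsP/andP=> [[[a v] /= [aN vn [-> ->]]]|[xN wn]].
  by rewrite mem_iota in aN; split.
by exists (x, w); rewrite mem_iota.
Qed.

Lemma words_uniq n : uniq (words n).
Proof.
elim: n => //= n IHn; apply: allpairs_uniq; rewrite ?iota_uniq //.
by move=> [a v] [b w] _ _ [-> ->].
Qed.

Lemma size_words n w : w \in words n -> size w = n.
Proof. by rewrite mem_words => /andP[/eqP]. Qed.

Section Sums.
Variable V : nmodType.
Local Open Scope ring_scope.
Implicit Types F : seq nat -> V.

Lemma sum_words_cons n F :
  \sum_(w <- words n.+1) F w = \sum_(a < N) \sum_(w <- words n) F ((a : nat) :: w).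
Proof.
by rewrite /= big_allpairs_dep /= -(big_mkord xpredT (fun a => \sum_(w <- words n) F (a :: w)))
  /index_iota subn0.
Qed.

Lemma sum_words_cat m k F :
  \sum_(w <- words (m + k)) F w =
  \sum_(u <- words m) \sum_(v <- words k) F (u ++ v).
Proof.
elim: m F => [|m IHm] F; first by rewrite big_seq1.
by rewrite addSn !sum_words_cons; apply: eq_bigr => a _; rewrite IHm.
Qed.

Lemma sum_words1 F : \sum_(w <- words 1) F w = \sum_(a < N) F [:: (a : nat)].
Proof. by rewrite sum_words_cons; apply: eq_bigr => a _; rewrite big_seq1. Qed.

Lemma sum_words_split n F :
  \sum_(w <- words n) F w =
  \sum_(m < n.+1) \sum_(u <- words m | sorted leq u)
    \sum_(v <- words (n - m) | desarrangement v) F (u ++ v).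
Proof.
transitivity (\sum_(w <- words n) \sum_(m < n.+1)
    if sorted leq (take m w) && desarrangement (drop m w) then F w else 0).
  rewrite big_seq_cond [RHS]big_seq_cond; apply: eq_bigr => w; rewrite andbT => wn.
  rewrite -big_mkcond /= sumr_const.
  have := sorted_desarrangement_split w; rewrite (size_words wn).
  by rewrite -big_mkcond sum1_card => ->.
rewrite exchange_big; apply: eq_bigr => m _ /=.
rewrite -{1}(@subnKC m n) -1?ltnS // sum_words_cat [RHS]big_mkcond.
rewrite big_seq_cond [RHS]big_seq_cond; apply: eq_bigr => u; rewrite andbT => um.
have su := size_words um.
rewrite -su; case: ifP => us; last first.
  by rewrite big1 // => v _; rewrite take_size_cat // us.
rewrite [RHS]big_mkcond; apply: eq_bigr => v _.
by rewrite take_size_cat // drop_size_cat // us.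
Qed.

(** The place where a crystal operator acts: the leftmost unmatched [i.+1] for [c = i.+1], the
    rightmost unmatched [i] for [c = i]. *)
Definition marked i c w m :=
  [&& nth 0%N w m == c, (brk i (take m w)).2 == 0%N & (brk i (drop m.+1 w)).1 == 0%N].

Lemma sum_marked i c n (P : pred (seq nat)) F : (c < N)%N ->
  (forall w, P w -> (\sum_(m < size w) marked i c w m)%N = 1%N) ->
  \sum_(w <- words n | P w) F w =
  \sum_(m < n) \sum_(u <- words m) \sum_(v <- words (n - m.+1) |
     [&& (brk i u).2 == 0%N, (brk i v).1 == 0%N & P (u ++ c :: v)]) F (u ++ c :: v).
Proof.
move=> cN Puniq.
transitivity (\sum_(w <- words n) \sum_(m < n)
    if P w && marked i c w m then F w else 0).
  rewrite big_mkcond big_seq_cond [RHS]big_seq_cond; apply: eq_bigr => w.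
  rewrite andbT => wn; case: ifP => [Pw|_]; last by rewrite big1.
  rewrite -big_mkcond /= sumr_const.
  have := Puniq w Pw; rewrite (size_words wn).
  by rewrite -big_mkcond sum1_card => ->.
rewrite exchange_big; apply: eq_bigr => m _ /=.
have En : n = (m + (1 + (n - m.+1)))%N by have := ltn_ord m; lia.
rewrite {1}En sum_words_cat.
rewrite big_seq_cond [RHS]big_seq_cond; apply: eq_bigr => u; rewrite andbT => um.
have su := size_words um.
rewrite sum_words_cat sum_words1 (bigD1 (Ordinal cN)) //= [X in _ + X]big1 ?addr0; last first.
  move=> a ac; rewrite big1 // => v _; case: ifP => // /andP[_ /and3P[]].
  by rewrite nth_cat su ltnn subnn /= => /eqP Ea; case/eqP: ac; apply: val_inj.
rewrite [RHS]big_mkcond; apply: eq_bigr => v _.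
rewrite /marked nth_cat su ltnn subnn /= eqxx -su take_size_cat //.
rewrite drop_cat ltnNge leqnSn /= subSn // subnn /= drop0.
by rewrite andbC -andbA.
Qed.

End Sums.

Lemma marked_cons0 i c x w k :
  marked i c (x :: w) 0 && (k <= (brk i (take 0 (x :: w))).1) =
  [&& x == c, (brk i w).1 == 0 & k == 0].
Proof. by rewrite /marked /= drop0 leqn0 -andbA. Qed.

Lemma marked_consS i c x w m k :
  marked i c (x :: w) m.+1 && (k <= (brk i (take m.+1 (x :: w))).1) =
  marked i c w m && ((if x == i then k.-1 else if x == i.+1 then k.+1 else k)
       <= (brk i (take m w)).1).
Proof.
rewrite /marked /=; case: (brk i (take m w)) => a b.
case: (nth 0 w m == c) => //=; case: (_.1 == 0); rewrite ?andbT ?andbF //=.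
case: (x =P i) => [->|?]; last case: (x =P i.+1) => [_|?].
- have -> : (i == i.+1) = false by lia.
  by rewrite /= sub0n addn0 subn0; lia.
- by rewrite /=; lia.
- by rewrite /= sub0n addn0 subn0.
Qed.

(** The bound [k] serves the induction: an [i.+1] put in front has to be matched by one more
    unmatched [i] of the prefix. For [k = 0] this says that the marked place exists, and is unique,
    as soon as some [i.+1] is unmatched. *)
Lemma marked_count2 i w k :
  \sum_(m < size w) (marked i i.+1 w m && (k <= (brk i (take m w)).1)) =
  (0 < (brk i w).2) && (k <= (brk i w).1).
Proof.
elim: w k => [|x w IHw] k; first by rewrite big_ord0.
rewrite -[size _]/(size w).+1 big_ord_recl marked_cons0.
under eq_bigr => m _ do rewrite lift0 marked_consS.
rewrite IHw.
rewrite brk_cons; case: (brk i w) => a b; rewrite /brk_mul /brk_letter /=.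
case: (x =P i) => [->|?]; last case: (x =P i.+1) => [_|?].
- have -> : (i == i.+1) = false by lia.
  by rewrite /= sub0n addn0 subn0; lia.
- by case: a => [|a]; rewrite /= ?subn0 ?addn0; lia.
- by rewrite /= sub0n addn0 subn0.
Qed.

Lemma marked_count1 i w k :
  \sum_(m < size w) (marked i i w m && (k <= (brk i (take m w)).1)) =
  (k < (brk i w).1).
Proof.
elim: w k => [|x w IHw] k; first by rewrite big_ord0.
rewrite -[size _]/(size w).+1 big_ord_recl marked_cons0.
under eq_bigr => m _ do rewrite lift0 marked_consS.
rewrite IHw.
rewrite brk_cons; case: (brk i w) => a b; rewrite /brk_mul /brk_letter /=.
case: (x =P i) => [->|?]; last case: (x =P i.+1) => [_|?].
- have -> : (i == i.+1) = false by lia.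
  by rewrite /= subn0; lia.
- by rewrite /=; lia.
- by rewrite /= subn0.
Qed.

(** The bijectivity of the crystal operator as a change of variables: both sides are sums over
    factorizations [u c v] at the marked letter, with the same conditions on [u] and [v]. *)
Lemma sum_crystal (V : nmodType) (i n p q : nat) (F F' : seq nat -> V) : i.+1 < N ->
  (forall w w', crystal_step i w w' -> F w = F' w') ->
  (\sum_(w <- words n | brk i w == (p, q.+1)) F w =
   \sum_(w <- words n | brk i w == (p.+1, q)) F' w)%R.
Proof.
move=> iN FF'; rewrite (@sum_marked _ i i.+1 _ _ _ iN); last first.
  move=> w /eqP Ew; have := marked_count2 i w 0; rewrite Ew /= => <-.
  by apply: eq_bigr => m _; rewrite andbT.
rewrite (@sum_marked _ i i _ _ _ (ltnW iN)); last first.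
  move=> w /eqP Ew; have := marked_count1 i w 0; rewrite Ew /= => <-.
  by apply: eq_bigr => m _; rewrite andbT.
apply: eq_bigr => m _; apply: eq_bigr => u _.
rewrite (eq_bigl (fun v => [&& (brk i u).2 == 0, (brk i v).1 == 0 &
    brk i (u ++ i :: v) == (p.+1, q)])).
  apply: eq_bigr => v /and3P[/eqP u2 /eqP v1 _].
  by apply: FF'; exists u, v.
move=> v; rewrite !brk_cat !brk_cons brk_letter1 brk_letter2.
case: (brk i u) => a b; case: (brk i v) => c d /=; case: eqP => //= ->; case: eqP => //= ->.
by rewrite /brk_mul /= !xpair_eqE /= ?subn0 ?addn0 ?add0n; lia.
Qed.

Lemma brk_le i w : ((brk i w).1 <= size w) && ((brk i w).2 <= size w).
Proof.
elim: w => //= x w; case: (brk i w) => a b /= /andP[la lb].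
by case: (x == i); case: (x == i.+1); rewrite /= ?subn0 ?sub0n; lia.
Qed.

Definition content (w : seq nat) : {ffun 'I_N -> nat} :=
  [ffun a : 'I_N => count_mem (a : nat) w].

Definition swap (i j : 'I_N) (c : {ffun 'I_N -> nat}) : {ffun 'I_N -> nat} :=
  [ffun a => c (tperm i j a)].

Lemma swapK i j : involutive (swap i j).
Proof. by move=> c; apply/ffunP=> a; rewrite !ffunE tpermK. Qed.

Section Symmetry.
Variables (i j : 'I_N) (ij : j = i.+1 :> nat).

Definition shift k (c : {ffun 'I_N -> nat}) : {ffun 'I_N -> nat} :=
  [ffun a => if a == i then c a - k else if a == j then c a + k else c a].

Lemma content_crystal_step w w' : crystal_step i w w' ->
  content w = shift 1 (content w').
Proof.
case=> A [B [-> -> _ _]]; apply/ffunP=> a; rewrite !ffunE !count_cat /=.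
have E : (i.+1 == a) = (a == j) by rewrite -ij eq_sym.
rewrite E -[_ == a :> nat]/(i == a) [i == a]eq_sym.
have /negPf ji : j != i by apply/eqP=> /(congr1 val) /=; rewrite ij; lia.
case: (a =P i) => [->|_]; first by rewrite [i == j]eq_sym ji /=; lia.
by case: (a =P j) => _ /=; lia.
Qed.

Lemma sum_crystal_iter (V : nmodType) (n p q k : nat)
    (F : seq nat -> {ffun 'I_N -> nat} -> V) :
  (forall w w' c, crystal_step i w w' -> F w c = F w' c) ->
  (\sum_(w <- words n | brk i w == (p, (q + k)%N)) F w (content w) =
   \sum_(w <- words n | brk i w == ((p + k)%N, q)) F w (shift k (content w)))%R.
Proof.
have shift0 c : shift 0 c = c.
  by apply/ffunP=> a; rewrite ffunE subn0 addn0; do 2?case: ifP.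
have shiftS m c : shift 1 (shift m c) = shift m.+1 c.
  apply/ffunP=> a; rewrite !ffunE; case: (a == i); first by lia.
  by case: (a == j); lia.
elim: k p F => [|k IHk] p F Finv.
  by rewrite !addn0; apply: eq_bigr => w _; rewrite shift0.
rewrite !addnS (@sum_crystal _ i _ _ _ _ (fun w => F w (shift 1 (content w)))); first last.
- by move=> w w' ww'; rewrite (content_crystal_step ww') (Finv _ _ _ ww').
- by rewrite -ij.
rewrite (IHk _ (fun w c => F w (shift 1 c))); last by move=> w w' c /Finv.
by rewrite addSn; apply: eq_bigr => w _; rewrite shiftS.
Qed.

(** Reflecting every [i]-string exchanges the numbers of unmatched [i] and [i.+1], hence the
    contents at [i] and [j]. The weight is a separate argument of [F] because invariance is required
    in the word only. *)
Lemma sum_words_sym (V : nmodType) n (F : seq nat -> {ffun 'I_N -> nat} -> V) :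
  (forall w w' c, crystal_step i w w' -> F w c = F w' c) ->
  (\sum_(w <- words n) F w (content w) =
   \sum_(w <- words n) F w (swap i j (content w)))%R.
Proof.
move=> Finv.
have half p k (G : seq nat -> {ffun 'I_N -> nat} -> V) :
    (forall w w' c, crystal_step i w w' -> G w c = G w' c) ->
    (\sum_(w <- words n | brk i w == (p, (p + k)%N)) G w (content w) =
     \sum_(w <- words n | brk i w == ((p + k)%N, p)) G w (swap i j (content w)))%R.
  move=> Ginv; rewrite (sum_crystal_iter _ _ _ _ Ginv); apply: eq_bigr => w /eqP Ew.
  congr (G _ _); apply/ffunP=> a; rewrite !ffunE.
  have := brk_diff i w; rewrite Ew -ij => /= Ec.
  have /negPf ji : j != i by apply/eqP=> /(congr1 val) /=; rewrite ij; lia.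
  case: tpermP => [->|->|ai aj]; rewrite ?eqxx ?ji; try lia.
  by rewrite (introF eqP ai) (introF eqP aj).
have swap_class p q :
    (\sum_(w <- words n | brk i w == (p, q)) F w (content w) =
     \sum_(w <- words n | brk i w == (q, p)) F w (swap i j (content w)))%R.
  have [pq|/ltnW qp] := leqP p q; first by rewrite -(subnKC pq) half.
  rewrite -(subnKC qp) (half _ _ (fun w c => F w (swap i j c))).
    by apply: eq_bigr => w _; rewrite swapK.
  by move=> w w' c /Finv.
have part (G : seq nat -> V) : (\sum_(w <- words n) G w =
    \sum_(p < n.+1) \sum_(q < n.+1) \sum_(w <- words n | brk i w == (p : nat, q : nat)) G w)%R.
  under [RHS]eq_bigr => p _ do (under eq_bigr => q _ do rewrite big_mkcond).
  under [RHS]eq_bigr => p _ do rewrite exchange_big.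
  rewrite exchange_big /= big_seq_cond [RHS]big_seq_cond; apply: eq_bigr => w.
  rewrite andbT => /size_words wn; have := brk_le i w; rewrite wn => /andP[w1 w2].
  rewrite -ltnS in w1; rewrite -ltnS in w2.
  rewrite (bigD1 (Ordinal w1)) //= (bigD1 (Ordinal w2)) //= -surjective_pairing eqxx.
  rewrite big1 ?addr0; last first.
    move=> q qw; case: eqP => // Ew; case/eqP: qw; apply: val_inj => /=.
    by rewrite Ew.
  rewrite big1 ?addr0 // => p pw; rewrite big1 // => q _; case: eqP => // Ew.
  by case/eqP: pw; apply: val_inj; rewrite /= Ew.
rewrite (part (fun w => F w (content w))) (part (fun w => F w (swap i j (content w)))).
rewrite exchange_big; apply: eq_bigr => p _; apply: eq_bigr => q _.
exact: swap_class.
Qed.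

End Symmetry.
End Words.

(** * Alternants *)

Local Open Scope ring_scope.

Section Polynomials.
Variable N : nat.
Local Notation P := {mpoly rat[N]}.
Local Notation weight := {ffun 'I_N -> nat}.

(** The Euler operator of one variable; on generating polynomials it multiplies by the number of
    letters [a]. The Laplacian [lap] below is the sum of the squares of these. *)
Definition theta (a : 'I_N) (f : P) : P := 'X_a * f^`M(a).

Fact theta_is_linear a : linear (theta a).
Proof. by move=> k f g; rewrite /theta linearP mulrDr scalerAr. Qed.
HB.instance Definition _ a := GRing.isLinear.Build rat P P _ (theta a) (theta_is_linear a).

Lemma thetaM a f g : theta a (f * g) = theta a f * g + f * theta a g.
Proof. by rewrite /theta mderivM; ring. Qed.

Definition mon (c : weight) : P := 'X_[[multinom c a | a < N]].

Lemma theta_mon a c : theta a (mon c) = (c a)%:R *: mon c.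
Proof.
rewrite /theta /mon mderivX mnmE -scalerAr; have [->|ca] := eqVneq (c a) 0%N.
  by rewrite !scale0r.
congr (_ *: _); rewrite -mpolyXD; congr 'X_[_]; apply/mnmP=> b.
rewrite mnmDE mnmBE mnm1E !mnmE.
by case: eqP => [<-|_]; rewrite ?subn0 //= subnKC // lt0n.
Qed.

Definition wadd (c d : weight) : weight := [ffun a => (c a + d a)%N].

Lemma monD c d : mon (wadd c d) = mon c * mon d.
Proof.
by rewrite /mon -mpolyXD; congr 'X_[_]; apply/mnmP=> a; rewrite mnmDE !mnmE ffunE.
Qed.

Definition lap (f : P) : P := \sum_a theta a (theta a f).

Fact lap_is_linear : linear lap.
Proof.
move=> k f g; rewrite /lap scaler_sumr -big_split; apply: eq_bigr => a _ /=.
by rewrite !linearP.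
Qed.
HB.instance Definition _ := GRing.isLinear.Build rat P P _ lap lap_is_linear.

Lemma lapM f g :
  lap (f * g) = lap f * g + \sum_a theta a f * theta a g *+ 2 + f * lap g.
Proof.
rewrite /lap !(mulr_suml, mulr_sumr) -!big_split; apply: eq_bigr => a _ /=.
by rewrite (thetaM a f g) linearD /= (thetaM a (theta a f)) (thetaM a f); ring.
Qed.

Lemma lap_mon c : lap (mon c) = (\sum_a (c a ^ 2)%N)%:R *: mon c.
Proof.
rewrite /lap natr_sum scaler_suml; apply: eq_bigr => a _.
by rewrite theta_mon linearZ /= theta_mon scalerA natrX expr2.
Qed.

Definition wperm (s : 'S_N) (c : weight) : weight := [ffun a => c (s a)].

Definition alt (k : weight) : P := \sum_(s : 'S_N) (-1) ^+ s *: mon (wperm s k).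

Lemma alt_swap i j k : i != j -> alt (swap i j k) = - alt k.
Proof.
move=> ij; rewrite /alt (reindex_inj (mulIg (tperm i j))) /= -sumrN.
apply: eq_bigr => s _; rewrite odd_permM odd_tperm ij addbT signrN scaleNr.
congr (- (_ *: mon _)); apply/ffunP=> a; rewrite !ffunE permM.
by rewrite tpermK.
Qed.

Lemma lap_alt k : lap (alt k) = (\sum_a (k a ^ 2)%N)%:R *: alt k.
Proof.
rewrite /alt linear_sum scaler_sumr; apply: eq_bigr => s _.
rewrite linearZ /= lap_mon !scalerA mulrC; congr (_%:R * _ *: _).
by rewrite [RHS](reindex_inj (@perm_inj _ s)); apply: eq_bigr => a _; rewrite ffunE.
Qed.

Definition delta : weight := [ffun a : 'I_N => (N.-1 - a)%N].

Lemma tperm_rec (i j k : 'I_N) : i != j -> i != k -> j != k ->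
  (tperm i j * tperm j k * tperm i j = tperm i k)%g.
Proof.
move=> ij ik jk; have ji : j != i by rewrite eq_sym.
have ki : k != i by rewrite eq_sym.
have kj : k != j by rewrite eq_sym.
apply/permP=> a; rewrite !permM.
have [<-|ia] := eqVneq i a; first by rewrite !tpermL tpermD.
have [<-|ja] := eqVneq j a; first by rewrite tpermR [tperm j k i]tpermD // tpermL tpermD.
have [<-|ka] := eqVneq k a; first by rewrite [tperm i j k]tpermD // !tpermR.
by rewrite [tperm i j a]tpermD // [tperm j k a]tpermD // !tpermD.
Qed.

Lemma perm_adjacent_ind (Q : 'S_N -> Prop) :
  Q 1%g -> (forall s t, Q s -> Q t -> Q (s * t)%g) ->
  (forall i j : 'I_N, j = i.+1 :> nat -> Q (tperm i j)) -> forall s, Q s.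
Proof.
move=> Q1 QM Qadj s.
have Qt d (i j : 'I_N) : j = (i + d.+1)%N :> nat -> Q (tperm i j).
  elim: d i j => [|d IHd] i j ijd; first by apply: Qadj; rewrite ijd addn1.
  have kN : (i + d.+1 < N)%N by have := ltn_ord j; lia.
  rewrite -(@tperm_rec i (Ordinal kN) j); first last.
  - by apply/eqP=> /(congr1 val) /=; lia.
  - by apply/eqP=> /(congr1 val) /=; lia.
  - by apply/eqP=> /(congr1 val) /=; lia.
  by apply/QM; [apply/QM|]; try exact: IHd; apply/Qadj; rewrite /= ijd; lia.
have [ts -> _] := prod_tpermP s.
elim: ts => [|[i j] ts IHts]; first by rewrite big_nil.
rewrite big_cons; apply/QM => //=.
have [ij|ji|ij] := ltngtP i j.
- by apply: (Qt (j - i).-1); lia.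
- by rewrite tpermC; apply: (Qt (i - j).-1); lia.
- by rewrite (val_inj ij) tperm1.
Qed.

Lemma sum_words_perm (V : nmodType) n (F : seq nat -> weight -> V) s :
  (forall i w w' c, crystal_step i w w' -> F w c = F w' c) ->
  \sum_(w <- words N n) F w (content N w) =
  \sum_(w <- words N n) F w (wperm s (content N w)).
Proof.
move: s F; apply: (@perm_adjacent_ind (fun s => forall F : seq nat -> weight -> V,
  (forall i w w' c, crystal_step i w w' -> F w c = F w' c) -> _)).
- by move=> F _; apply: eq_bigr => w _; congr (F w _); apply/ffunP=> a; rewrite !ffunE perm1.
- move=> s t IHs IHt F Finv; rewrite IHs //.
  rewrite (IHt (fun w c => F w (wperm s c))); last by move=> i w w' c /Finv.
  by apply: eq_bigr => w _; congr (F w _); apply/ffunP=> a; rewrite !ffunE permM.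
- by move=> i j ij F Finv; apply: (sum_words_sym ij) => w w' c; apply: Finv.
Qed.

Definition crystal_invariant (T : Type) (g : seq nat -> T) : Prop :=
  forall i w w', crystal_step i w w' -> g w = g w'.

Definition gensum (n : nat) (g : seq nat -> rat) : P :=
  \sum_(w <- words N n) g w *: mon (content N w).

(** Since the content can be permuted under the sum, each permutation of the alternant may act on
    the content as well. The result has the shape of the numerators in Weyl's character formula. *)
Lemma alt_delta_gensum n g : crystal_invariant g ->
  alt delta * gensum n g = \sum_(w <- words N n) g w *: alt (wadd delta (content N w)).
Proof.
move=> ginv; rewrite /alt mulr_suml.
under [RHS]eq_bigr => w _ do rewrite scaler_sumr.
rewrite exchange_big; apply: eq_bigr => s _ /=.
rewrite /gensum mulr_sumr.
rewrite (sum_words_perm n (F := fun w c => (-1) ^+ s *: mon (wperm s delta) * (g w *: mon c)) s).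
  apply: eq_bigr => w _; rewrite -scalerAr -scalerAl -monD.
  by congr (_ *: (_ *: mon _)); apply/ffunP=> a; rewrite !ffunE.
by move=> i w w' c /ginv ->.
Qed.

Definition yam (w : seq nat) : bool := [forall i : 'I_N, (brk i w).2 == 0%N].

Lemma crystal_step_cat i u u' v : (brk i v).1 = 0%N ->
  crystal_step i u u' -> crystal_step i (u ++ v) (u' ++ v).
Proof.
move=> v1 [A [B [-> -> A2 B1]]]; exists A, (B ++ v); split; rewrite -?catA //.
by rewrite brk_cat; move: v1 B1; case: (brk i B) => a b; case: (brk i v) => c d /= -> ->.
Qed.

Lemma content_cat u v : content N (u ++ v) = wadd (content N u) (content N v).
Proof. by apply/ffunP=> a; rewrite !ffunE count_cat. Qed.

(* The sum over the prefixes of a word is antisymmetric under the exchange of i and i + 1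
   when its minimal non-Yamanouchi suffix fails at i. *)
Lemma alt_non_yam m g (c : 'I_N) v : crystal_invariant g -> yam v -> ~~ yam ((c : nat) :: v) ->
  \sum_(u <- words N m) g (u ++ (c : nat) :: v) *:
    alt (wadd delta (content N (u ++ (c : nat) :: v))) = 0.
Proof.
move=> ginv /forallP yv; rewrite negb_forall => /existsP[i].
have := eqP (yv i); rewrite brk_cons; case Ev: (brk i v) => [p q] /= q0.
rewrite {}q0 in Ev * => pc.
have [ci p0] : c = i.+1 :> nat /\ p = 0%N.
  by move: pc; rewrite /brk_mul /brk_letter /=; case: (c =P i.+1 :> nat) => //=; lia.
have brk_cv : brk i ((c : nat) :: v) = (0, 1)%N.
  by rewrite brk_cons ci brk_letter2 Ev p0.
set d := wadd delta (content N ((c : nat) :: v)).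
have ic : i != c by apply/eqP=> /(congr1 val) /=; rewrite ci; lia.
(* The word [c v] has one more [i.+1] than [i], and [delta] decreases by one from [i] to [i.+1]; the
   two compensate. *)
have d_swap : swap i c d = d.
  have := brk_diff i ((c : nat) :: v); rewrite brk_cv -ci /= add0n => cnt.
  by apply/ffunP=> a; rewrite !ffunE /=; case: tpermP => [->|->|//];
    have := ltn_ord c; move: cnt; rewrite ci /=; lia.
have altE u : alt (wadd delta (content N (u ++ (c : nat) :: v))) = alt (wadd d (content N u)).
  by congr alt; apply/ffunP=> a; rewrite content_cat !ffunE; lia.
under eq_bigr do rewrite altE.
set S := \sum_(u <- _) _.
have : S = - S.
  rewrite {1}/S (@sum_words_sym N i c ci _ m
    (fun u x => g (u ++ (c : nat) :: v) *: alt (wadd d x))).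
    rewrite -sumrN; apply: eq_bigr => u _; rewrite -scalerN -(alt_swap _ ic).
    congr (_ *: alt _); apply/ffunP=> a; rewrite !ffunE.
    by move: (congr1 (fun f : weight => f a) d_swap); rewrite !ffunE /=; lia.
  by move=> u u' x uu'; rewrite (ginv _ _ _ (crystal_step_cat _ uu')) ?brk_cv.
move/eqP; rewrite -addr_eq0 -mulr2n -scaler_nat scaler_eq0 pnatr_eq0 /=.
by move/eqP.
Qed.

Lemma yam_behead x w : yam (x :: w) -> yam w.
Proof.
by move=> /forallP yw; apply/forallP=> i; apply/eqP/(@brk_suffix2 i [:: x])/eqP/yw.
Qed.

(** The required Yamanouchi suffix is lengthened one letter at a time, at the expense of the prefix.
    The words lost on the way cancel by [alt_non_yam]. *)
Lemma alt_delta_gensum_yam n g : crystal_invariant g ->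
  alt delta * gensum n g =
  \sum_(w <- words N n | yam w) g w *: alt (wadd delta (content N w)).
Proof.
move=> ginv; rewrite alt_delta_gensum //.
pose F w := g w *: alt (wadd delta (content N w)).
pose Y m k := \sum_(u <- words N m) \sum_(v <- words N k | yam v) F (u ++ v).
have YS m k : Y m.+1 k = Y m k.+1.
  rewrite /Y -addn1 sum_words_cat.
  under eq_bigr => u _ do rewrite sum_words1.
  under [RHS]eq_bigr => u _ do rewrite big_mkcond sum_words_cons.
  rewrite exchange_big [RHS]exchange_big; apply: eq_bigr => a _ /=.
  under eq_bigr => u _ do rewrite big_mkcond.
  rewrite exchange_big [RHS]exchange_big; apply: eq_bigr => v _ /=.
  have [yv|nyv] := boolP (yam v); last first.
    by rewrite !big1 // => u _; case: ifP => // /yam_behead; rewrite (negPf nyv).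
  have [yav|nyav] := boolP (yam ((a : nat) :: v)).
    by apply: eq_bigr => u _; rewrite -catA.
  rewrite [RHS]big1 // -[RHS](alt_non_yam m ginv yv nyav).
  by apply: eq_bigr => u _; rewrite -catA.
have Yn m k : Y m k = Y 0%N (m + k)%N.
  by elim: m k => // m IHm k; rewrite YS IHm addnS.
have := Yn n 0%N; rewrite addn0 /Y big_seq1 /= => <-.
apply: eq_bigr => u _; rewrite big_mkcond big_seq1 cats0.
by have -> : yam [::] by apply/forallP.
Qed.

End Polynomials.

(** * Freudenthal's formula *)

Section Freudenthal.
Variable N : nat.
Local Notation P := {mpoly rat[N]}.
Local Notation weight := {ffun 'I_N -> nat}.

Lemma content_size w : all (ltn^~ N) w -> (\sum_(a < N) content N w a)%N = size w.
Proof.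
elim: w => [|x w IHw] /=; first by rewrite big1 // => a _; rewrite ffunE.
case/andP=> xN /IHw <-.
rewrite (bigD1 (Ordinal xN)) //= [in RHS](bigD1 (Ordinal xN)) //= !ffunE /= eqxx -addSn.
congr addn; apply: eq_bigr => a ax; rewrite !ffunE /=.
by case: eqP => // xa; case/eqP: ax; apply: val_inj.
Qed.

Definition dbl_diag (w : seq nat) : rat := (diag (recording_tableau w) *+ 2)%:~R.

Lemma dbl_diag_crystal : crystal_invariant dbl_diag.
Proof. by move=> i w w' /shape_crystal_step /diag_shape E; rewrite /dbl_diag E. Qed.

Definition sqdelta : rat := (\sum_a (delta N a ^ 2)%N)%:R.

(** Completing the square: with [d = N - 1 - a], the contribution [c * (c - 1) - 2 * c * a] of a row
    of length [c] equals [(d + c) ^ 2 - d ^ 2 - (2 * N - 1) * c]. *)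
Lemma dbl_diag_yam n w : w \in words N n -> yam N w ->
  dbl_diag w = (\sum_a (wadd (delta N) (content N w) a ^ 2)%N)%:R
    - (sqdelta + (N%:R *+ 2 - 1) * n%:R).
Proof.
rewrite mem_words => /andP[/eqP wn wN] /forallP yw.
rewrite /dbl_diag (yam_diag wN); last first.
  move=> i; have [iN|Ni] := ltnP i N; first exact: (eqP (yw (Ordinal iN))).
  apply: brk_notin2; apply/negP=> /(allP wN) /=; rewrite ltnNge; lia.
rewrite -wn -(content_size wN) /sqdelta !natr_sum rmorph_sum /= mulr_sumr opprD.
rewrite addrA -sumrB -sumrB; apply: eq_bigr => a _.
rewrite !ffunE; set c := count_mem _ _.
have -> : (N.-1 - a)%N = (N - a.+1)%N by have := ltn_ord a; lia.
rewrite !natrX natrD natrB // -natr1.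
by rewrite !(rmorphB, rmorphM, rmorphMn) /= -!pmulrn; ring.
Qed.

(** By [dbl_diag_yam], the factor [dbl_diag] is, up to a constant, the eigenvalue of [lap] on the
    alternant attached to a Yamanouchi word. *)
Lemma alt_delta_diag n g : crystal_invariant g ->
  alt (delta N) * gensum N n (fun w => dbl_diag w * g w) =
  lap (alt (delta N) * gensum N n g)
  - (sqdelta + (N%:R *+ 2 - 1) * n%:R) *: (alt (delta N) * gensum N n g).
Proof.
move=> ginv; rewrite !alt_delta_gensum_yam //; last first.
  by move=> i w w' ww'; rewrite (dbl_diag_crystal ww') (ginv _ _ _ ww').
rewrite linear_sum scaler_sumr -sumrB big_seq_cond [RHS]big_seq_cond.
apply: eq_bigr => w /andP[wn yw].
rewrite linearZ /= lap_alt !scalerA -scalerBl (dbl_diag_yam wn yw).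
by congr (_ *: _); ring.
Qed.

Lemma mderiv_prod (I : eqType) (a : 'I_N) (r : seq I) (F : I -> P) : uniq r ->
  theta a (\prod_(p <- r) F p) =
  \sum_(p <- r) theta a (F p) * \prod_(q <- r | q != p) F q.
Proof.
elim: r => [|p r IHr] /=; first by rewrite !big_nil /theta mderivC mulr0.
case/andP=> pr Ur; rewrite !big_cons thetaM IHr // eqxx /=; congr (_ * _ + _).
  rewrite big_seq [RHS]big_seq_cond; apply: eq_big => [q|//].
  by rewrite andbC; case: eqP => // ->; rewrite (negPf pr).
rewrite mulr_sumr [LHS]big_seq [RHS]big_seq; apply: eq_bigr => q qr.
rewrite big_cons; case: eqP => [pq|_]; first by rewrite pq qr in pr.
by rewrite /=; ring.
Qed.

Definition pairs : seq ('I_N * 'I_N) := 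
  [seq p : 'I_N * 'I_N <- enum {: 'I_N * 'I_N} | (p.1 < p.2)%N].

Definition pair_diff (p : 'I_N * 'I_N) : P := 'X_p.2 - 'X_p.1.

Lemma mem_pairs p : (p \in pairs) = (p.1 < p.2)%N.
Proof. by rewrite mem_filter mem_enum andbT. Qed.

Lemma pairs_uniq : uniq pairs.
Proof. by rewrite filter_uniq ?enum_uniq. Qed.

Lemma alt_delta_prod : exists b : bool,
  alt (delta N) = (-1) ^+ b *: \prod_(p <- pairs) pair_diff p.
Proof.
pose x : 'rV[P]_N := \row_j 'X_j.
have altE : alt (delta N) = \det (\matrix_(i, j) ('X_i : P) ^+ delta N j).
  apply: eq_bigr => s _; rewrite -mul_mpolyC rmorphXn /= rmorphN1; congr (_ * _).
  rewrite /mon mpolyXE_id; apply: eq_bigr => i _; by rewrite mxE mnmE ffunE.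
have revK : injective (@rev_ord N) by exact: rev_ord_inj.
exists (perm revK); rewrite altE.
rewrite -det_tr; have -> : (\matrix_(i, j) ('X_i : P) ^+ delta N j)^T =
    row_perm (perm revK) (Vandermonde N x).
  apply/matrixP=> i j; rewrite !mxE permE /= ffunE; congr (_ ^+ _).
  by have := ltn_ord i; lia.
rewrite row_permE det_mulmx det_perm det_Vandermonde -mul_mpolyC rmorphXn /= rmorphN1.
congr (_ * _); rewrite /pairs big_filter big_enum_cond /= pair_big_dep /=.
by apply: eq_big => [p|p _]; rewrite ?inE // !mxE.
Qed.

Lemma alt_delta_neq0 : alt (delta N) != 0.
Proof.
have [b ->] := alt_delta_prod; rewrite scaler_eq0 signr_eq0 /= prodf_seq_neq0.
apply/allP=> -[i j]; rewrite mem_pairs => /= ij; rewrite subr_eq0.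
apply/eqP=> /(congr1 (fun f : P => f@_(U_(j)))); rewrite !mcoeffX eqxx eq_mnm1.
case: eqP => [Eij|_ /eqP]; last by rewrite oner_eq0.
by move: ij; rewrite -Eij ltnn.
Qed.

Lemma theta_X (a b : 'I_N) : theta a 'X_b = if b == a then 'X_a else 0.
Proof.
rewrite /theta mderivX mnm1E; case: eqP => [->|_]; last by rewrite scale0r mulr0.
have -> : (U_(a) - U_(a))%MM = 0%MM by apply/mnmP=> i; rewrite mnmBE subnn mnm0E.
by rewrite scale1r mpolyX0 mulr1.
Qed.

Lemma alt_delta_factors : exists W : 'I_N -> 'I_N -> P,
  [/\ forall a b, a != b -> ('X_a - 'X_b) * W a b = alt (delta N),
      forall a b, a != b -> W b a = - W a b &
      forall a, theta a (alt (delta N)) = \sum_(b | b != a) 'X_a * W a b].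
Proof.
have [s altE] := alt_delta_prod.
pose C (i j : 'I_N) : P := (-1) ^+ s *: \prod_(q <- pairs | q != (i, j)) pair_diff q.
have CE (i j : 'I_N) : (i < j)%N -> ('X_j - 'X_i) * C i j = alt (delta N).
  move=> ij; rewrite altE (bigD1_seq (i, j)) ?mem_pairs ?pairs_uniq //=.
  by rewrite /C -scalerAr.
exists (fun a b : 'I_N => if (a < b)%N then - C a b else C b a); split.
- move=> a b ab; case: ltngtP => [lt_ab|lt_ba|/val_inj Eab].
  + by rewrite -(CE _ _ lt_ab); ring.
  + by rewrite -(CE _ _ lt_ba).
  + by rewrite Eab eqxx in ab.
- move=> a b ab; case: ltngtP => [lt_ab|lt_ba|/val_inj Eab] //; first by rewrite opprK.
  by rewrite Eab eqxx in ab.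
move=> a; rewrite altE linearZ /= mderiv_prod ?pairs_uniq // scaler_sumr.
rewrite /pairs big_filter big_enum_cond /=.
transitivity (\sum_(i < N) \sum_(j < N)
    if (i < j)%N then ((if j == a then 'X_a else 0) - (if i == a then 'X_a else 0)) * C i j else 0).
  rewrite pair_big /= big_mkcond; apply: eq_bigr => -[i j] _ /=; case: ifP => // _.
  by rewrite linearB /= !theta_X /C -scalerAr.
transitivity (\sum_(i < N) (if (i < a)%N then 'X_a * C i a else 0)
   - \sum_(j < N) if (a < j)%N then 'X_a * C a j else 0).
  rewrite -sumrB.
  transitivity (\sum_(i < N) \sum_(j < N) ((if (i < j)%N && (j == a) then 'X_a * C i j else 0)
     - if (i < j)%N && (i == a) then 'X_a * C i j else 0)).
    apply: eq_bigr => i _; apply: eq_bigr => j _.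
    by do 3?[case: ifP => _] => /=; ring.
  under eq_bigr => i _ do rewrite sumrB.
  rewrite !sumrB; congr (_ - _).
    apply: eq_bigr => i _; rewrite (bigD1 a) //= eqxx andbT big1 ?addr0 // => j /negPf ->.
    by rewrite andbF.
  rewrite (bigD1 a) //= [X in _ + X]big1 ?addr0 => [|i /negPf ia]; last first.
    by rewrite big1 // => j _; rewrite ia andbF.
  by apply: eq_bigr => j _; rewrite eqxx andbT.
rewrite -sumrB [RHS]big_mkcond; apply: eq_bigr => i _.
case: (ltngtP i a) => [ia|ai|/val_inj ->]; rewrite ?eqxx ?subr0 ?sub0r //=.
- by case: eqP => // Eia; rewrite Eia ltnn in ia.
- by case: eqP => // Eia; [rewrite Eia ltnn in ai | rewrite mulrN].
Qed.

(* The trace form of Freudenthal's recursion: [T] is a generating polynomial of traces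
   on weight spaces, and [U a b] that of the traces twisted by the product of the root
   operators of [(a, b)] and [(b, a)]. *)
Lemma freudenthal n (T : P) (U : 'I_N -> 'I_N -> P) :
  \sum_a theta a T = n%:R *: T ->
  (forall a, U a a = theta a (theta a T)) ->
  (forall a b, a != b -> ('X_a - 'X_b) * U a b = 'X_b * (theta a T - theta b T)) ->
  alt (delta N) * (\sum_a \sum_b U a b) =
  lap (alt (delta N) * T) - (sqdelta + (N%:R - 1) * n%:R) *: (alt (delta N) * T).
Proof.
move=> homT Uaa Uab; have [W [WE Wopp thetaV]] := alt_delta_factors.
set V := alt (delta N) in WE thetaV *.
have lapV : lap V = sqdelta *: V by rewrite lap_alt.
rewrite lapM lapV.
transitivity (V * lap T + \sum_a \sum_(b | b != a) V * U a b).
  rewrite mulr_sumr /lap mulr_sumr -big_split; apply: eq_bigr => a _ /=.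
  by rewrite (bigD1 a) //= Uaa mulrDr mulr_sumr.
suff -> : \sum_a \sum_(b | b != a) V * U a b =
    \sum_a theta a V * theta a T *+ 2 - ((N%:R - 1) * n%:R) *: (V * T).
  by rewrite scalerDl -scalerAl; ring.
have -> : ((N%:R - 1) * n%:R) *: (V * T) = \sum_a \sum_(b | b != a) V * theta a T.
  rewrite -scalerA scalerAr -homT mulr_sumr scaler_sumr; apply: eq_bigr => a _.
  rewrite sumr_const -scaler_nat; congr (_ *: _).
  by rewrite (eq_card (B := predC1 a)) // cardC1 card_ord -subn1 natrB //; case: (N) a => [[]|].
have pairE a b : b != a -> V * U a b = W a b * 'X_b * theta a T + W b a * 'X_b * theta b T.
  move=> ba; rewrite -(WE a b) 1?eq_sym // mulrC mulrA [U a b * _]mulrC Uab 1?eq_sym //.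
  by rewrite (Wopp a b) 1?eq_sym //; ring.
(* Exchanging [a] and [b] in the second half of [pairE] collects everything on [theta a T]. *)
have -> : \sum_a \sum_(b | b != a) V * U a b =
    \sum_a \sum_(b | b != a) (W a b * ('X_a + 'X_b) * theta a T).
  transitivity (\sum_a (\sum_(b | b != a) W a b * 'X_b * theta a T) +
      \sum_a (\sum_(b | b != a) W b a * 'X_b * theta b T)).
    rewrite -big_split; apply: eq_bigr => a _; rewrite -big_split.
    by apply: eq_bigr => b /pairE.
  rewrite [X in _ + X](exchange_big_dep xpredT) //= -big_split; apply: eq_bigr => a _ /=.
  rewrite [X in _ + X](eq_bigl (fun b => b != a)); last by move=> b; rewrite eq_sym.
  by rewrite -big_split; apply: eq_bigr => b _ /=; ring.
(* Here ['X_a + 'X_b] is read as [2 'X_a - ('X_a - 'X_b)]: the first part gives the derivative of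
   [V], the second one gives [V] itself. *)
rewrite -sumrB; apply: eq_bigr => a _.
rewrite thetaV mulr_suml -mulr_natl mulr_sumr -sumrB; apply: eq_bigr => b ba.
by rewrite -(WE a b) 1?eq_sym //; ring.
Qed.

End Freudenthal.

(** * Factorization of words *)

Lemma sorted_change (i : nat) (A B : seq nat) : last i A != i.+1 -> head i.+1 B != i ->
  sorted leq (A ++ i.+1 :: B) = sorted leq (A ++ i :: B).
Proof.
move=> A_last B_head.
have E0 : sorted leq (i.+1 :: B) = sorted leq (i :: B).
  by case: B B_head => // b B /= bi; rewrite [(i <= b)%N]leq_eqVlt eq_sym (negPf bi).
elim: A A_last {B_head} => [|a A IHA] A_last //.
have sorted2 (x y : nat) s : sorted leq (x :: y :: s) = (x <= y)%N && sorted leq (y :: s) by [].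
case: A IHA A_last => [|a1 A] IHA A_last.
  by rewrite !cat_cons !sorted2 E0 [(a <= i.+1)%N]leq_eqVlt (negPf A_last).
by rewrite !cat_cons !sorted2 -!cat_cons IHA.
Qed.

Lemma sorted_crystal : crystal_invariant (fun w => sorted leq w).
Proof.
by move=> i w w' [A [B [-> -> /brk_last A2 /brk_head B1]]]; apply: sorted_change.
Qed.

Lemma insertion_tableau_row w : sorted leq w -> (0 < size w)%N ->
  insertion_tableau w = [:: w].
Proof.
elim/last_ind: w => // w x IHw ws _; rewrite insertion_tableau_rcons.
move: ws; rewrite -cats1 sorted_leq_cat => /and3P[ws _ wx].
case: w ws wx IHw => [|y w] ws wx IHw; first by [].
rewrite IHw // tableau_insert_cons row_insert_append ?cats1 //.
by move: wx; rewrite allrel1r.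
Qed.

Lemma dbl_diag_sorted w : sorted leq w ->
  dbl_diag w = (size w)%:R * ((size w)%:R - 1).
Proof.
case: (posnP (size w)) => [/size0nil -> _|w0 ws].
  by rewrite /dbl_diag /diag big_ord0 mul0r.
rewrite /dbl_diag (diag_shape (shape_recording w)) insertion_tableau_row //.
rewrite /diag /= big_ord1 /= sum_row mulr0 mul0rn subr0.
by rewrite rmorphM rmorphB /=.
Qed.

Section Recursion.
Variable N : nat.
Local Notation P := {mpoly rat[N]}.
Local Notation weight := {ffun 'I_N -> nat}.

Lemma eq_gensum n (f g : seq nat -> rat) :
  (forall w, w \in words N n -> f w = g w) -> gensum N n f = gensum N n g.
Proof.
move=> fg; rewrite /gensum big_seq_cond [RHS]big_seq_cond.
by apply: eq_bigr => w /andP[/fg ->].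
Qed.

Lemma gensumD n f g : gensum N n (fun w => f w + g w) = gensum N n f + gensum N n g.
Proof. by rewrite -big_split; apply: eq_bigr => w _; rewrite scalerDl. Qed.

Lemma gensumZ n k g : gensum N n (fun w => k * g w) = k *: gensum N n g.
Proof. by rewrite scaler_sumr; apply: eq_bigr => w _; rewrite scalerA. Qed.

Lemma gensumB n f g : gensum N n (fun w => f w - g w) = gensum N n f - gensum N n g.
Proof. by rewrite -sumrB; apply: eq_bigr => w _; rewrite scalerBl. Qed.

Lemma theta_gensum n g : \sum_a theta a (gensum N n g) = n%:R *: gensum N n g.
Proof.
under eq_bigr => a _ do rewrite linear_sum.
rewrite exchange_big scaler_sumr big_seq_cond [RHS]big_seq_cond.
apply: eq_bigr => w /andP[wn _] /=.
under eq_bigr => a _ do rewrite linearZ /= theta_mon.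
move: wn; rewrite mem_words => /andP[/eqP <- wN].
rewrite -scaler_sumr -scaler_suml -natr_sum content_size //.
by rewrite !scalerA mulrC.
Qed.

(** The complete homogeneous symmetric polynomial of degree [m], as the generating polynomial of the
    increasing factors. *)
Definition hsum (m : nat) : P := gensum N m (fun u => (sorted leq u)%:R).
Definition dsum (g : seq nat -> rat) (k : nat) : P :=
  gensum N k (fun v => (desarrangement v)%:R * g v).

Lemma gensum_split n g :
  gensum N n (fun w => g (even_ascent_suffix w)) =
  \sum_(m < n.+1) hsum m * dsum g (n - m).
Proof.
rewrite /gensum sum_words_split; apply: eq_bigr => m _.
rewrite /hsum /dsum /gensum mulr_suml big_mkcond; apply: eq_bigr => u _.
case: (boolP (sorted leq u)) => us; last by rewrite scale0r mul0r.
rewrite scale1r mulr_sumr big_mkcond; apply: eq_bigr => v _.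
case: (boolP (desarrangement v)) => vd; last by rewrite mul0r scale0r mulr0.
by rewrite even_ascent_suffix_cat // mul1r content_cat monD scalerAr.
Qed.

Lemma desarrangement_crystal : crystal_invariant desarrangement.
Proof. by move=> i w w' /first_ascent_crystal_step E; rewrite /desarrangement E. Qed.

Lemma suffix_crystal (T : Type) (g : seq nat -> T) : crystal_invariant g ->
  crystal_invariant (fun w => g (even_ascent_suffix w)).
Proof.
move=> ginv i w w' /even_ascent_suffix_crystal_step[-> //|]; exact: ginv.
Qed.

(** All sorted words of length [m] have the same one-row shape, so [dbl_diag] is constant on
    them. *)
Lemma lap_alt_delta_hsum m :
  lap (alt (delta N) * hsum m) =
  (m%:R * (m%:R - 1) + (sqdelta N + (N%:R *+ 2 - 1) * m%:R)) *: (alt (delta N) * hsum m).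
Proof.
have sinv : crystal_invariant (fun w => (sorted leq w)%:R : rat).
  by move=> i w w' /sorted_crystal ->.
rewrite scalerDl; apply/eqP; rewrite -subr_eq -(alt_delta_diag N m sinv) scalerAr.
apply/eqP; congr (_ * _); rewrite -gensumZ; apply: eq_gensum => w.
rewrite mem_words => /andP[/eqP wn _]; case: (boolP (sorted leq w)) => ws; last by rewrite !mulr0.
by rewrite dbl_diag_sorted // wn.
Qed.

(** Against the alternant, both diagonal sums become Laplacians, one of the product of the three
    factors and one without the increasing factor. By the Leibniz rule, the difference keeps the
    eigenvalue for [hsum] and the cross term of the two factors of the word. *)
Lemma gensum_dbl_diag_split n g : crystal_invariant g ->
  gensum N n (fun w => (dbl_diag w - dbl_diag (even_ascent_suffix w))
     * g (even_ascent_suffix w)) =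
  \sum_(m < n.+1) ((m%:R * (m%:R - 1)) *: (hsum m * dsum g (n - m))
     + \sum_a theta a (hsum m) * theta a (dsum g (n - m)) *+ 2).
Proof.
move=> ginv; apply: (mulfI (alt_delta_neq0 N)).
have -> : gensum N n (fun w => (dbl_diag w - dbl_diag (even_ascent_suffix w))
     * g (even_ascent_suffix w)) =
  gensum N n (fun w => dbl_diag w * g (even_ascent_suffix w))
  - gensum N n (fun w => dbl_diag (even_ascent_suffix w) * g (even_ascent_suffix w)).
  by rewrite -gensumB; apply: eq_gensum => w _; rewrite mulrBl.
rewrite mulrBr (alt_delta_diag N n (suffix_crystal ginv)) gensum_split.
rewrite (gensum_split n (fun v => dbl_diag v * g v)) !mulr_sumr linear_sum scaler_sumr -!sumrB.
apply: eq_bigr => -[m ltm] _ /=; set k := (n - m)%N.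
have -> : dsum (fun v => dbl_diag v * g v) k =
    gensum N k (fun v => dbl_diag v * ((desarrangement v)%:R * g v)).
  by apply: eq_gensum => v _; ring.
set E := gensum N k _; have EE := @alt_delta_diag N k (fun v => (desarrangement v)%:R * g v).
rewrite [alt _ * (_ * E)]mulrCA {}EE; last first.
  by move=> i w w' ww'; rewrite (desarrangement_crystal ww') (ginv _ _ _ ww').
rewrite -/(dsum g k) mulrA lapM lap_alt_delta_hsum [lap (alt _ * dsum g k)]lapM lap_alt -/(sqdelta N).
set D := alt _; set h := hsum m; set d := dsum g k; clearbody D h d => {E}.
have -> : n%:R = m%:R + k%:R :> rat by rewrite -natrD subnKC // -ltnS.
have -> : \sum_a theta a (D * h) * theta a d *+ 2 =
    h * (\sum_a theta a D * theta a d *+ 2) + D * (\sum_a theta a h * theta a d *+ 2).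
  by rewrite !mulr_sumr -big_split; apply: eq_bigr => a _; rewrite /= thetaM; ring.
rewrite -!mul_mpolyC !(mpolyCD, mpolyCM, mpolyCB, rmorphD, rmorphM, rmorphB, rmorphMn) /=.
by ring.
Qed.

(** Twice the bracket in the definition of [eig]. *)
Definition casimir (w : seq nat) : rat := dbl_diag w + (size w * (size w).+1)%:R.

Lemma casimir_crystal : crystal_invariant casimir.
Proof.
by move=> i w w' ww'; rewrite /casimir (dbl_diag_crystal ww') (crystal_step_size ww').
Qed.

Definition rsum (g : seq nat -> rat) (n : nat) (a : 'I_N) : P :=
  \sum_(m < n.+1) (n%:R *: (theta a (hsum m) * dsum g (n - m))
     + theta a (hsum m) * theta a (dsum g (n - m))).

(** For [n = m + k] one has [m (m - 1) + n (n + 1) - k (k + 1) = 2 m n], and [m] times [hsum m] is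
    the sum of its Euler derivatives. This is the origin of the coefficient [n] in [rsum] and of its
    splitting over the letters. *)
Lemma gensum_casimir n g : crystal_invariant g ->
  gensum N n (fun w => (casimir w - casimir (even_ascent_suffix w))
     * g (even_ascent_suffix w)) = (\sum_a rsum g n a) *+ 2.
Proof.
move=> ginv.
pose G v := - (size v * (size v).+1)%:R * g v.
rewrite (@eq_gensum _ _ (fun w => (dbl_diag w - dbl_diag (even_ascent_suffix w))
     * g (even_ascent_suffix w) + ((n * n.+1)%:R * g (even_ascent_suffix w)
     + G (even_ascent_suffix w)))); last first.
  by move=> w /size_words <-; rewrite /casimir /G; ring.
rewrite !gensumD gensum_dbl_diag_split // gensumZ !gensum_split scaler_sumr -!big_split /=.
rewrite /rsum exchange_big /= -sumrMnl; apply: eq_bigr => -[m ltm] _ /=.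
set k := (n - m)%N.
have -> : \sum_a (n%:R *: (theta a (hsum m) * dsum g k) + theta a (hsum m) * theta a (dsum g k)) =
    n%:R *: (m%:R *: hsum m * dsum g k) + \sum_a theta a (hsum m) * theta a (dsum g k).
  by rewrite -theta_gensum mulr_suml scaler_sumr -big_split.
have -> : dsum G k = - (k * k.+1)%:R *: dsum g k.
  by rewrite -gensumZ; apply: eq_gensum => w /size_words wk; rewrite /G wk; ring.
have -> : n = (m + k)%N by rewrite subnKC // -ltnS.
rewrite sumrMnl !natrM !natrD -!natr1 -!mul_mpolyC.
rewrite !(mpolyCD, mpolyCM, mpolyCB, rmorphD, rmorphM, rmorphN, rmorphB, rmorph1) /=.
by ring.
Qed.

Lemma theta_hsum0 a : theta a (hsum 0) = 0.
Proof.
rewrite /hsum /gensum big_seq1 linearZ /= theta_mon ffunE /=.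
by rewrite scale0r scaler0.
Qed.

Lemma mcoeff_theta a (f : P) k : (theta a f)@_k = (k a)%:R * f@_k.
Proof.
have monE m : 'X_[m] = mon [ffun b => m b] :> P.
  by congr 'X_[_]; apply/mnmP=> b; rewrite mnmE ffunE.
rewrite [f in LHS]mpolyE [f in RHS]mpolyE !linear_sum /= ?linear_sum /= mulr_sumr.
apply: eq_bigr => m _; rewrite linearZ /= !mcoeffZ monE theta_mon -monE mcoeffZ ffunE mcoeffX.
by case: eqP => [->|_]; rewrite ?mulr1 ?mulr0 // mulrC.
Qed.

Lemma sorted_words_count m (k : 'X_{1..N}) :
  \sum_(w <- words N m | sorted leq w) ([multinom content N w a | a < N] == k)%:R
  = (mdeg k == m)%:R :> rat.
Proof.
pose u := flatten [seq nseq (k a) (a : nat) | a <- enum 'I_N].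
have count_u (a : 'I_N) : count_mem (a : nat) u = k a.
  rewrite count_flatten -map_comp sumnE big_map big_enum (bigD1 a) //=.
  rewrite count_nseq /= eqxx mul1n big1 ?addn0 // => b ba.
  by rewrite count_nseq /= -[(b : nat) == a]/(b == a) (negPf ba).
have uN : all (ltn^~ N) u.
  by apply/allP=> x /flattenP[s /mapP[a _ ->]]; rewrite mem_nseq => /andP[_ /eqP->] /=.
have u_sorted : sorted leq u.
  have enum_s : sorted leq (map val (enum 'I_N)).
    by rewrite val_enum_ord iota_sorted.
  rewrite /u; elim: (enum _) enum_s => //= a s IHs; rewrite path_sortedE; last exact: leq_trans.
  case/andP=> /allP as_ /IHs s_s; rewrite sorted_leq_cat s_s /=.
  apply/andP; split.
    by elim: (k a) => // -[|d] //= ->; rewrite leqnn.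
  apply/allrelP=> x y; rewrite mem_nseq => /andP[_ /eqP->] /flattenP[r /mapP[b bs ->]].
  by rewrite mem_nseq => /andP[_ /eqP->]; apply: as_; rewrite map_f.
have size_u : size u = mdeg k.
  by rewrite -(content_size uN) mdegE; apply: eq_bigr => a _; rewrite ffunE count_u.
have uniq_u w : w \in words N m -> sorted leq w ->
    ([multinom content N w a | a < N] == k) = (w == u).
  rewrite mem_words => /andP[_ wN] w_s; apply/eqP/eqP => [/mnmP E|->]; last first.
    by apply/mnmP=> a; rewrite mnmE ffunE count_u.
  apply: (sorted_eq leq_trans anti_leq) => //; apply/allP=> x.
  rewrite mem_cat => xwu; have xN : (x < N)%N by case/orP: xwu => [/(allP wN)|/(allP uN)].
  by have := E (Ordinal xN); rewrite mnmE ffunE /= => ->; rewrite -count_u.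
rewrite big_seq_cond (eq_bigr (fun w => (w == u)%:R)); last first.
  by move=> w /andP[wn ws]; rewrite uniq_u.
rewrite -big_seq_cond; have [mk|mk] := eqVneq (mdeg k) m; last first.
  rewrite big_seq_cond big1 // => w /andP[wn _]; case: eqP => // wu.
  by case/eqP: mk; rewrite -size_u -wu (size_words wn).
have um : u \in words N m by rewrite mem_words size_u mk eqxx.
rewrite -big_filter (bigD1_seq u) /= ?filter_uniq ?words_uniq ?mem_filter ?u_sorted //.
by rewrite eqxx big1 ?addr0 // => w /negPf->.
Qed.

Lemma mcoeff_hsum m k : (hsum m)@_k = (mdeg k == m)%:R.
Proof.
rewrite /hsum /gensum raddf_sum /= -sorted_words_count [RHS]big_mkcond.
apply: eq_bigr => w _; rewrite mcoeffZ mcoeffX.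
by case: (sorted leq w); rewrite ?mul1r ?mul0r.
Qed.

(** Every monomial of the right degree has coefficient 1 in [hsum]; after removing the factor
    ['X_a], both sides have coefficient [k a + 1] at such a monomial [k]. *)
Lemma theta_hsumS m a : theta a (hsum m.+1) = 'X_a * (hsum m + theta a (hsum m)).
Proof.
congr (_ * _); apply/mpolyP=> k.
rewrite mcoeffD mcoeff_theta mcoeff_deriv !mcoeff_hsum mdegD mdeg1 addn1 eqSS.
by rewrite mulrS mulr_natl.
Qed.

(* The same recursion is satisfied by the traces of [sufmx N n ^+ s *m DSmx n a a]. *)
Lemma rsumS g n a : rsum g n.+1 a =
  'X_a * (rsum g n a + (n.+1%:R *: gensum N n (fun w => g (even_ascent_suffix w))
    + theta a (gensum N n (fun w => g (even_ascent_suffix w))))).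
Proof.
rewrite {1}/rsum big_ord_recl theta_hsum0 !mul0r scaler0 addr0 add0r.
rewrite gensum_split !linear_sum /= -!big_split mulr_sumr; apply: eq_bigr => -[m ltm] _ /=.
rewrite /bump add1n subSS theta_hsumS thetaM -!mul_mpolyC -natr1 mpolyCD mpolyC1.
by ring.
Qed.

Lemma rsum0 g a : rsum g 0 a = 0.
Proof. by rewrite /rsum big_ord1 theta_hsum0 !mul0r scaler0 addr0. Qed.

End Recursion.

(** * The operators on words *)

(** Results are listed with repetitions, one for each place, so that sums over the lists count the
    moves of the shuffle. *)
Fixpoint ins (a : nat) (w : seq nat) : seq (seq nat) :=
  if w is c :: w1 then (a :: w) :: [seq c :: v | v <- ins a w1] else [:: [:: a]].

Fixpoint del (b : nat) (w : seq nat) : seq (seq nat) :=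
  if w is c :: w1 then
    (if c == b then [:: w1] else [::]) ++ [seq c :: v | v <- del b w1]
  else [::].

Fixpoint rep (b a : nat) (w : seq nat) : seq (seq nat) :=
  if w is c :: w1 then
    (if c == b then [:: a :: w1] else [::]) ++ [seq c :: v | v <- rep b a w1]
  else [::].

Section ListOperators.
Implicit Types (f : seq nat -> rat) (w : seq nat) (a b c d : nat).

Lemma sum_ins a c w f :
  \sum_(v <- ins a (c :: w)) f v = f (a :: c :: w) + \sum_(v <- ins a w) f (c :: v).
Proof. by rewrite /= big_cons big_map. Qed.

Lemma sum_del b c w f :
  \sum_(v <- del b (c :: w)) f v = (c == b)%:R * f w + \sum_(v <- del b w) f (c :: v).
Proof.
rewrite /= big_cat big_map; case: (c == b); first by rewrite big_seq1 mul1r.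
by rewrite big_nil mul0r.
Qed.

Lemma sum_rep b a c w f :
  \sum_(v <- rep b a (c :: w)) f v =
  (c == b)%:R * f (a :: w) + \sum_(v <- rep b a w) f (c :: v).
Proof.
rewrite /= big_cat big_map; case: (c == b); first by rewrite big_seq1 mul1r.
by rewrite big_nil mul0r.
Qed.

Lemma sum_ins2 a c f (s : seq (seq nat)) :
  \sum_(v <- s) \sum_(u <- ins a (c :: v)) f u =
  \sum_(v <- s) f (a :: c :: v) + \sum_(v <- s) \sum_(u <- ins a v) f (c :: u).
Proof. by rewrite -big_split; apply: eq_bigr => v _; rewrite sum_ins. Qed.

Lemma sum_del2 b c f (s : seq (seq nat)) :
  \sum_(v <- s) \sum_(u <- del b (c :: v)) f u =
  (c == b)%:R * \sum_(v <- s) f v + \sum_(v <- s) \sum_(u <- del b v) f (c :: u).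
Proof. by rewrite mulr_sumr -big_split; apply: eq_bigr => v _; rewrite sum_del. Qed.

Lemma sum_rep2 b a c f (s : seq (seq nat)) :
  \sum_(v <- s) \sum_(u <- rep b a (c :: v)) f u =
  (c == b)%:R * \sum_(v <- s) f (a :: v) + \sum_(v <- s) \sum_(u <- rep b a v) f (c :: u).
Proof. by rewrite mulr_sumr -big_split; apply: eq_bigr => v _; rewrite sum_rep. Qed.

Definition sum_step := (sum_ins, sum_del, sum_rep, sum_ins2, sum_del2, sum_rep2).

(** Deleting the inserted letter itself gives the scalar term. Deleting another [b] merges the two
    places around it; the place in excess amounts to replacing this [b] by [a]. *)
Lemma ins_del a b w f :
  \sum_(v <- ins a w) \sum_(u <- del b v) f u =
  \sum_(v <- del b w) \sum_(u <- ins a v) f u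
  + (a == b)%:R * (size w).+1%:R * f w + \sum_(v <- rep b a w) f v.
Proof.
elim: w f => [|c w IHw] f.
  by rewrite big_seq1 sum_del !big_nil mulr1 add0r.
rewrite !sum_step.
by rewrite IHw -[(size w).+2%:R]natr1; ring.
Qed.

Lemma ins_ins a b w f :
  \sum_(v <- ins a w) \sum_(u <- ins b v) f u =
  \sum_(v <- ins b w) \sum_(u <- ins a v) f u.
Proof.
elim: w f => [|c w IHw] f.
  by rewrite !big_seq1 !sum_step !big_seq1 addrC.
rewrite !sum_step.
by rewrite IHw; ring.
Qed.

Lemma rep_rep b a d c w f :
  \sum_(v <- rep b a w) \sum_(u <- rep d c v) f u
    + (c == b)%:R * \sum_(v <- rep d a w) f v =
  \sum_(v <- rep d c w) \sum_(u <- rep b a v) f u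
    + (a == d)%:R * \sum_(v <- rep b c w) f v.
Proof.
elim: w f => [|x w IHw] f; first by rewrite !big_nil !mulr0.
rewrite !sum_step.
by rewrite (canRL (addrK _) (IHw (fun u => f (x :: u)))); ring.
Qed.

Lemma ins_rep c b a w f :
  \sum_(v <- ins c w) \sum_(u <- rep b a v) f u =
  \sum_(v <- rep b a w) \sum_(u <- ins c v) f u
    + (c == b)%:R * \sum_(v <- ins a w) f v.
Proof.
elim: w f => [|x w IHw] f.
  by rewrite !big_seq1 !sum_step !big_nil addr0 add0r.
rewrite !sum_step.
by rewrite IHw; ring.
Qed.

Lemma rep_del b a c w f :
  \sum_(v <- rep b a w) \sum_(u <- del c v) f u =
  \sum_(v <- del c w) \sum_(u <- rep b a v) f u
    + (a == c)%:R * \sum_(v <- del b w) f v.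
Proof.
elim: w f => [|x w IHw] f; first by rewrite !big_nil mulr0 addr0.
rewrite !sum_step.
by rewrite IHw; ring.
Qed.

Lemma rep_diag a w f : \sum_(v <- rep a a w) f v = (count_mem a w)%:R * f w.
Proof.
elim: w f => [|x w IHw] f; first by rewrite big_nil mul0r.
rewrite sum_rep IHw /= natrD mulrDl; congr (_ + _).
by case: eqP => [->|]; rewrite ?mul0r.
Qed.

End ListOperators.

(** * Matrices of the operators and their commutation relations *)

Section Matrices.
Variable N : nat.

Arguments words : simpl never.

Lemma ins_words n a w : (a < N)%N -> w \in words N n -> {subset ins a w <= words N n.+1}.
Proof.
move=> aN; elim: w n => [|c w IHw] n; rewrite mem_words => /andP[/eqP <- /= wN] v.
  by rewrite inE => /eqP ->; rewrite mem_words /= aN.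
rewrite inE => /predU1P[->|/mapP[u uw ->]]; first by rewrite mem_words /= aN wN !eqxx.
case/andP: wN => cN wN.
have := IHw (size w) _ u uw; rewrite !mem_words eqxx wN => /(_ isT) /= /andP[/eqP -> ->].
by rewrite cN eqxx.
Qed.

Lemma del_words n b w : w \in words N n.+1 -> {subset del b w <= words N n}.
Proof.
elim: w n => [|c w IHw] n; rewrite mem_words //= eqSS => /and3P[/eqP <- cN wN] v.
rewrite mem_cat => /orP[|/mapP[u uw ->]].
  by case: ifP => //; rewrite inE => _ /eqP ->; rewrite mem_words eqxx.
case: w wN uw IHw => [|d w] // wN uw IHw.
have := IHw (size w) _ u uw; rewrite !mem_words eqxx wN => /(_ isT) /= /andP[/eqP -> ->].
by rewrite cN eqxx.
Qed.

Lemma rep_words n b a w : (a < N)%N -> w \in words N n -> {subset rep b a w <= words N n}.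
Proof.
move=> aN; elim: w n => [|c w IHw] n; rewrite mem_words //= => /and3P[/eqP <- cN wN] v.
rewrite mem_cat => /orP[|/mapP[u uw ->]].
  by case: ifP => //; rewrite inE => _ /eqP ->; rewrite mem_words /= aN wN eqxx.
have := IHw (size w) _ u uw; rewrite !mem_words eqxx wN => /(_ isT) /= /andP[/eqP -> ->].
by rewrite cN eqxx.
Qed.

Definition dimw (n : nat) : nat := size (words N n).
Definition wd (n : nat) (i : 'I_(dimw n)) : seq nat := nth [::] (words N n) i.

Lemma wd_in n (i : 'I_(dimw n)) : wd i \in words N n.
Proof. exact: mem_nth. Qed.

Lemma wd_inj n : injective (@wd n).
Proof.
by move=> i j /eqP; rewrite nth_uniq ?words_uniq // => /eqP/val_inj.
Qed.

Lemma sum_wd (V : nmodType) n (F : seq nat -> V) :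
  \sum_(i < dimw n) F (wd i) = \sum_(w <- words N n) F w.
Proof. by rewrite (big_nth [::]) big_mkord. Qed.

Lemma wd_index n w : w \in words N n -> exists i : 'I_(dimw n), wd i = w.
Proof.
move=> wn; have wi : (index w (words N n) < dimw n)%N by rewrite index_mem.
by exists (Ordinal wi); rewrite /wd nth_index.
Qed.

(* Row convention: the first factor of a product acts first. *)
Definition opmx n m (A : seq nat -> seq (seq nat)) : 'M[rat]_(dimw n, dimw m) :=
  \matrix_(i, j) \sum_(v <- A (wd i)) (v == wd j)%:R.

Lemma opmxM n m k A B i (j : 'I_(dimw k)) :
  (forall w, w \in words N n -> {subset A w <= words N m}) ->
  (opmx n m A *m opmx m k B) i j =
  \sum_(v <- A (wd i)) \sum_(u <- B v) (u == wd j)%:R.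
Proof.
move=> Asub; rewrite mxE.
under eq_bigr => l _ do rewrite !mxE mulr_suml.
rewrite exchange_big big_seq_cond [RHS]big_seq_cond /=.
apply: eq_bigr => v; rewrite andbT => /(Asub _ (wd_in i)) /wd_index[l <-].
rewrite (bigD1 l) //= eqxx mul1r [X in _ + X]big1 ?addr0 // => l' l'l.
by case: eqP => [/wd_inj ll|_]; [rewrite ll eqxx in l'l | rewrite mul0r].
Qed.

Definition Smx n (a : 'I_N) : 'M[rat]_(dimw n, dimw n.+1) := opmx n n.+1 (ins a).
Definition Dmx n (b : 'I_N) : 'M[rat]_(dimw n.+1, dimw n) := opmx n.+1 n (del b).
Definition Emx n (b a : 'I_N) : 'M[rat]_(dimw n) := opmx n n (rep b a).

(* Deleting [b], then inserting [a]; there is nothing to delete in the empty word. *)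
Definition DSmx n (b a : 'I_N) : 'M[rat]_(dimw n) :=
  match n with 0 => 0 | n1.+1 => Dmx n1 b *m Smx n1 a end.

Lemma DSmxE n b a i j :
  DSmx n b a i j = \sum_(v <- del b (wd i)) \sum_(u <- ins a v) (u == wd j)%:R.
Proof.
case: n i j => [|n] i j; last by rewrite opmxM // => w; apply: del_words.
rewrite mxE; have := wd_in i; rewrite mem_words => /andP[/eqP/size0nil -> _].
by rewrite big_nil.
Qed.

Lemma SmxDmx n a b :
  Smx n a *m Dmx n b = DSmx n b a + ((a == b)%:R * n.+1%:R)%:M + Emx n b a.
Proof.
apply/matrixP=> i j; rewrite opmxM; last by move=> w; apply: ins_words.
rewrite ins_del !mxE DSmxE (size_words (wd_in i)) (inj_eq (@wd_inj n)).
by rewrite -val_eqE mulr_natr.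
Qed.

Lemma SmxSmx n a b : Smx n a *m Smx n.+1 b = Smx n b *m Smx n.+1 a.
Proof.
apply/matrixP=> i j; rewrite (@opmxM _ _ _ _ _ _ _ (fun w => @ins_words n a w (ltn_ord a))).
by rewrite (@opmxM _ _ _ _ _ _ _ (fun w => @ins_words n b w (ltn_ord b))) ins_ins.
Qed.

Lemma EmxEmx n b a d c :
  Emx n b a *m Emx n d c =
  Emx n d c *m Emx n b a + (a == d)%:R *: Emx n b c - (c == b)%:R *: Emx n d a.
Proof.
apply/esym/eqP; rewrite subr_eq; apply/eqP/matrixP=> i j; rewrite [LHS]mxE [RHS]mxE.
rewrite !(@opmxM _ _ _ _ _ _ _ (fun w => @rep_words n _ _ w (ltn_ord _))).
by rewrite [X in _ + X = _]mxE [X in _ = _ + X]mxE !mxE rep_rep.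
Qed.

Lemma SmxEmx n c b a :
  Smx n c *m Emx n.+1 b a = Emx n b a *m Smx n c + (c == b)%:R *: Smx n a.
Proof.
apply/matrixP=> i j; rewrite [RHS]mxE.
rewrite (@opmxM _ _ _ _ _ _ _ (fun w => @ins_words n c w (ltn_ord c))).
rewrite (@opmxM _ _ _ _ _ _ _ (fun w => @rep_words n b a w (ltn_ord a))).
by rewrite ins_rep [X in _ = _ + X]mxE mxE.
Qed.

Lemma EmxDmx n b a c :
  Emx n.+1 b a *m Dmx n c = Dmx n c *m Emx n b a + (a == c)%:R *: Dmx n b.
Proof.
apply/matrixP=> i j; rewrite [RHS]mxE.
rewrite (@opmxM _ _ _ _ _ _ _ (fun w => @rep_words n.+1 b a w (ltn_ord a))).
rewrite (@opmxM _ _ _ _ _ _ _ (fun w => @del_words n c w)).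
by rewrite rep_del [X in _ = _ + X]mxE mxE.
Qed.

Lemma Emx_diag n a i j : Emx n a a i j = (count_mem (a : nat) (wd i))%:R *+ (i == j).
Proof. by rewrite mxE rep_diag (inj_eq (@wd_inj n)) mulr_natr. Qed.

Definition r2r n : 'M[rat]_(dimw n) := \sum_b DSmx n b b.

Definition omega n : 'M[rat]_(dimw n) := \sum_a \sum_b Emx n b a *m Emx n a b.

(* The eigenvalues are n (n + 1) + 2 diag(Q), since [omega] is n N plus twice the sum
   of the transpositions of positions. *)
Definition casmx n : 'M[rat]_(dimw n) :=
  (n%:R * n.+1%:R - n%:R * N%:R)%:M + omega n.

Definition sufmx n : 'M[rat]_(dimw n) := casmx n - r2r n *+ 2.

Lemma sum_delta (V : lmodType rat) (c : 'I_N) (F : 'I_N -> V) :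
  \sum_a (c == a)%:R *: F a = F c.
Proof.
rewrite (bigD1 c) //= eqxx scale1r big1 ?addr0 // => a /negPf ac.
by rewrite eq_sym ac scale0r.
Qed.

Lemma sum_delta' (V : lmodType rat) (c : 'I_N) (F : 'I_N -> V) :
  \sum_a (a == c)%:R *: F a = F c.
Proof. by rewrite -[RHS](sum_delta c); apply: eq_bigr => a _; rewrite eq_sym. Qed.

Lemma omega_comm n c d : comm_mx (Emx n c d) (omega n).
Proof.
rewrite /comm_mx /omega mulmx_sumr mulmx_suml; apply/eqP; rewrite -subr_eq0 -sumrB; apply/eqP.
under eq_bigr => a _ do rewrite mulmx_sumr mulmx_suml -sumrB.
(* The terms produced by commuting past each factor in turn; contracting the deltas makes them
   cancel in pairs, as for any Casimir element. *)
pose F a b := (d == b)%:R *: (Emx n c a *m Emx n a b) - (a == c)%:R *: (Emx n b d *m Emx n a b)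
  + ((d == a)%:R *: (Emx n b a *m Emx n c b) - (b == c)%:R *: (Emx n b a *m Emx n a d)).
transitivity (\sum_a \sum_b F a b).
  apply: eq_bigr => a _; apply: eq_bigr => b _; rewrite /F.
  rewrite mulmxA EmxEmx !(mulmxDl, mulNmx) -!scalemxAl.
  rewrite -[Emx n b a *m Emx n c d *m _]mulmxA [Emx n c d *m Emx n a b]EmxEmx.
  rewrite !(mulmxDr, mulmxN) -!scalemxAr mulmxA.
  set X := _ *m _ *m _; set Y1 := _ *: _; set Y2 := _ *: _; set Y3 := _ *: _; set Y4 := _ *: _.
  by rewrite -!addrA [LHS]addrC -!addrA addNr addr0 [LHS]addrA [LHS]addrC -addrA.
rewrite /F; under eq_bigr => a _ do rewrite big_split /= !sumrB sum_delta sum_delta'.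
rewrite big_split /= !sumrB /=.
have -> : \sum_a \sum_b (a == c)%:R *: (Emx n b d *m Emx n a b) =
    \sum_b Emx n b d *m Emx n c b.
  by rewrite exchange_big; apply: eq_bigr => b _; rewrite sum_delta'.
have -> : \sum_a \sum_b (d == a)%:R *: (Emx n b a *m Emx n c b) =
    \sum_b Emx n b d *m Emx n c b.
  by rewrite exchange_big; apply: eq_bigr => b _; rewrite sum_delta.
by rewrite addrA subrK subrr.
Qed.

End Matrices.

(** * Traces *)

Section Traces.
Variable N : nat.
Local Notation P := {mpoly rat[N]}.
Arguments words : simpl never.

Lemma Smx_omega n (c : 'I_N) :
  Smx n c *m omega N n.+1 =
  omega N n *m Smx n c + (\sum_b Emx n b c *m Smx n b) *+ 2 + N%:R *: Smx n c.
Proof.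
rewrite /omega mulmx_sumr mulmx_suml.
transitivity (\sum_a \sum_b (Emx n b a *m Emx n a b *m Smx n c
  + (c == a)%:R *: (Emx n b a *m Smx n b)
  + (c == b)%:R *: (Emx n a b *m Smx n a + Smx n b))).
  apply: eq_bigr => a _; rewrite mulmx_sumr; apply: eq_bigr => b _.
  rewrite mulmxA SmxEmx mulmxDl -scalemxAl SmxEmx eqxx scale1r -mulmxA SmxEmx.
  by rewrite mulmxDr mulmxA -scalemxAr.
under eq_bigr => a _ do rewrite !big_split /= sum_delta -scaler_sumr.
rewrite !big_split /= sum_delta mulr2n addrA sumr_const card_ord scaler_nat.
rewrite [in RHS]addrA; do 3!congr (_ + _).
by apply: eq_bigr => a _; rewrite mulmx_suml.
Qed.

(** This fixes the scalar in [casmx]: [n (n + 1)] grows by [2 (n + 1)] with the length, and [- n N]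
    absorbs the term [N] of [Smx_omega]. The remainder is exactly twice that of [Smx_r2r]. *)
Lemma Smx_casmx n (c : 'I_N) :
  Smx n c *m casmx N n.+1 =
  casmx N n *m Smx n c + (\sum_b Emx n b c *m Smx n b + n.+1%:R *: Smx n c) *+ 2.
Proof.
rewrite /casmx mulmxDr mulmxDl Smx_omega mul_mx_scalar mul_scalar_mx.
have -> : n.+1%:R * n.+2%:R - n.+1%:R * N%:R =
    (n%:R * n.+1%:R - n%:R * N%:R) + (n.+1%:R *+ 2 - N%:R) :> rat.
  by rewrite -![_.+1%:R]natr1; ring.
move: (n%:R * n.+1%:R - _) => k; rewrite [in LHS]scalerDl scalerBl -[(_ *+ 2) *: _]scalerMnl mulrnDl.
by rewrite addrACA subrK -!addrA.
Qed.

Lemma DSmx_Smx n (a b : 'I_N) : DSmx n b a *m Smx n b = DSmx n b b *m Smx n a.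
Proof. by case: n => [|n]; rewrite ?mul0mx // -!mulmxA SmxSmx. Qed.

Lemma Smx_r2r n (a : 'I_N) :
  Smx n a *m r2r N n.+1 =
  r2r N n *m Smx n a + (\sum_b Emx n b a *m Smx n b + n.+1%:R *: Smx n a).
Proof.
rewrite /r2r mulmx_sumr mulmx_suml.
transitivity (\sum_b (DSmx n b b *m Smx n a + (Emx n b a *m Smx n b
   + (a == b)%:R *: (n.+1%:R *: Smx n b)))).
  apply: eq_bigr => b _; rewrite [DSmx n.+1 b b]/= mulmxA SmxDmx !mulmxDl DSmx_Smx.
  by rewrite mul_scalar_mx scalerA -addrA [X in _ + X]addrC.
by rewrite !big_split /= sum_delta.
Qed.

Lemma Smx_sufmx n (a : 'I_N) : Smx n a *m sufmx N n.+1 = sufmx N n *m Smx n a.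
Proof.
rewrite /sufmx mulmxBr mulmxBl Smx_casmx.
have -> : Smx n a *m (r2r N n.+1 *+ 2) = (Smx n a *m r2r N n.+1) *+ 2.
  by rewrite !mulr2n mulmxDr.
have -> : (r2r N n *+ 2) *m Smx n a = (r2r N n *m Smx n a) *+ 2.
  by rewrite !mulr2n mulmxDl.
rewrite Smx_r2r; move: (_ + n.+1%:R *: _) => X.
by rewrite mulrnDl [r2r N n *m _ *+ 2 + _]addrC addrKA.
Qed.
Lemma Emx_r2r_comm n (c d : 'I_N) : GRing.comm (Emx n c d) (r2r N n).
Proof.
case: n => [|n]; first by rewrite /r2r big1 //; exact: commr0.
rewrite /GRing.comm -[LHS]/(_ *m _) -[RHS]/(_ *m _) /r2r mulmx_sumr mulmx_suml.
transitivity (\sum_b (Dmx n b *m Smx n b *m Emx n.+1 c d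
  + ((d == b)%:R *: (Dmx n c *m Smx n b) - (b == c)%:R *: (Dmx n b *m Smx n d)))).
  apply: eq_bigr => b _; rewrite /DSmx mulmxA EmxDmx mulmxDl -scalemxAl.
  rewrite -[Dmx n b *m Smx n b *m _]mulmxA SmxEmx mulmxDr -scalemxAr mulmxA.
  by rewrite [X in _ = _ + X]addrC addrA addrK.
rewrite !big_split /= sumrN sum_delta sum_delta' subrr addr0.
by apply: eq_bigr => b _.
Qed.

Lemma Emx_casmx_comm n (c d : 'I_N) : GRing.comm (Emx n c d) (casmx N n).
Proof.
apply: commrD; last exact: omega_comm.
exact/comm_mx_sym/comm_scalar_mx.
Qed.

Lemma Emx_sufmx_comm n (c d : 'I_N) : GRing.comm (Emx n c d) (sufmx N n).
Proof.
apply: commrB; first exact: Emx_casmx_comm.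
by apply: commrMn; exact: Emx_r2r_comm.
Qed.

Lemma commr_suml (R : pzRingType) (I : Type) (s : seq I) (F : I -> R) (x : R) :
  (forall i, GRing.comm x (F i)) -> GRing.comm x (\sum_(i <- s) F i).
Proof. by move=> xF; apply: (big_ind (GRing.comm x)) => //; [exact: commr0|exact: commrD]. Qed.

Lemma casmx_r2r_comm n : GRing.comm (r2r N n) (casmx N n).
Proof.
apply: commrD; first exact/comm_mx_sym/comm_scalar_mx.
apply: commr_suml => a; apply: commr_suml => b.
by apply: commrM; apply/commr_sym; exact: Emx_r2r_comm.
Qed.

Lemma casmx_sufmx_comm n : GRing.comm (casmx N n) (sufmx N n).
Proof.
apply: commrB; first exact: commr_refl.
by apply: commrMn; apply/commr_sym; exact: casmx_r2r_comm.
Qed.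

Definition wtr n (A : 'M[rat]_(dimw N n)) : P :=
  \sum_i A i i *: mon (content N (wd i)).

Fact wtr_is_linear n : linear (@wtr n).
Proof.
move=> k A B; rewrite /wtr scaler_sumr -big_split; apply: eq_bigr => i _ /=.
by rewrite !mxE scalerDl scalerA.
Qed.
HB.instance Definition _ n := GRing.isLinear.Build rat _ P _ (@wtr n) (@wtr_is_linear n).

(** Cyclicity of the trace, twisted by the content: if [B] shifts contents, carrying it around the
    trace multiplies by a ratio of monomials, written without denominators by means of [f] and
    [g]. *)
Lemma wtrC n m (B : 'M[rat]_(dimw N n, dimw N m)) C (f g : P) :
  (forall i j, B i j != 0 ->
     f * mon (content N (wd i)) = g * mon (content N (wd j))) ->
  f * wtr (B *m C) = g * wtr (C *m B).
Proof.
move=> Bfg; rewrite /wtr !mulr_sumr.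
under eq_bigr => i _ do rewrite mxE -scalerAr scaler_suml.
under [RHS]eq_bigr => j _ do rewrite mxE -scalerAr scaler_suml.
rewrite [RHS]exchange_big; apply: eq_bigr => i _; apply: eq_bigr => j _ /=.
have [->|Bij] := eqVneq (B i j) 0; first by rewrite mul0r mulr0 !scale0r.
by rewrite (Bfg _ _ Bij) mulrC.
Qed.

Lemma sum_mem_neq0 (s : seq (seq nat)) u : \sum_(v <- s) (v == u)%:R != 0 :> rat -> u \in s.
Proof.
apply: contra_neqT => us; rewrite big_seq big1 // => v vs.
by case: eqP => // vu; rewrite -vu vs in us.
Qed.

Lemma mon_cons (a : 'I_N) w : mon (content N ((a : nat) :: w)) = 'X_a * mon (content N w).
Proof.
rewrite /mon -mpolyXD; congr 'X_[_]; apply/mnmP=> b.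
by rewrite mnmDE mnm1E !mnmE !ffunE /= -val_eqE.
Qed.

Lemma mon_ins (a : 'I_N) w v : v \in ins a w -> mon (content N v) = 'X_a * mon (content N w).
Proof.
elim: w v => [|c w IHw] v /=; first by rewrite inE => /eqP ->; exact: mon_cons.
rewrite inE => /predU1P[->|/mapP[u uw ->]]; first exact: mon_cons.
have contE x (y : seq nat) : content N (x :: y) = wadd (content N [:: x]) (content N y).
  by rewrite -content_cat.
by rewrite contE monD (IHw _ uw) mulrCA -monD -contE.
Qed.

Lemma mon_rep (b a : 'I_N) w v : v \in rep b a w ->
  'X_a * mon (content N w) = 'X_b * mon (content N v).
Proof.
elim: w v => [|c w IHw] v //=; rewrite mem_cat => /orP[|/mapP[u uw ->]].
  by case: eqP => // ->; rewrite inE => /eqP ->; rewrite !mon_cons mulrCA.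
have contE x (y : seq nat) : content N (x :: y) = wadd (content N [:: x]) (content N y).
  by rewrite -content_cat.
by rewrite contE [content N (c :: u)]contE !monD mulrCA (IHw _ uw) mulrCA.
Qed.

Lemma wtr_Smx n (a : 'I_N) C : 'X_a * wtr (Smx n a *m C) = wtr (C *m Smx n a).
Proof.
rewrite -[RHS]mul1r; apply: wtrC => i j; rewrite mxE => /sum_mem_neq0/mon_ins ->.
by rewrite mul1r.
Qed.

Lemma wtr_Emx n (b a : 'I_N) C : 'X_a * wtr (Emx n b a *m C) = 'X_b * wtr (C *m Emx n b a).
Proof. by apply: wtrC => i j; rewrite mxE => /sum_mem_neq0/mon_rep ->. Qed.

Lemma wtr_Emx_diag n (a : 'I_N) C : wtr (C *m Emx n a a) = theta a (wtr C).
Proof.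
rewrite /wtr linear_sum; apply: eq_bigr => i _; rewrite linearZ /= theta_mon scalerA ffunE.
rewrite mxE (bigD1 i) //= Emx_diag eqxx mulr1n big1 ?addr0 // => j /negPf ji.
by rewrite Emx_diag ji mulr0n mulr0.
Qed.

Lemma theta_wtr n (A : 'M[rat]_(dimw N n)) : \sum_a theta a (wtr A) = n%:R *: wtr A.
Proof.
under eq_bigr => a _ do rewrite linear_sum.
rewrite exchange_big scaler_sumr; apply: eq_bigr => i _ /=.
under eq_bigr => a _ do rewrite linearZ /= theta_mon.
have := wd_in i; rewrite mem_words => /andP[/eqP wn wN].
rewrite -scaler_sumr -scaler_suml -natr_sum content_size // wn.
by rewrite !scalerA mulrC.
Qed.

Definition commutes_gl n (A : 'M[rat]_(dimw N n)) : Prop :=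
  forall c d : 'I_N, Emx n c d *m A = A *m Emx n c d.

(** Twisted cyclicity relates [U a b] and [U b a] by a ratio of variables, and the commutator of the
    two root operators gives their difference. Together they yield the hypothesis of
    [freudenthal]. *)
Lemma wtr_casmx n (A : 'M[rat]_(dimw N n)) : commutes_gl A ->
  alt (delta N) * wtr (casmx N n *m A) =
  lap (alt (delta N) * wtr A)
  - (sqdelta N + (N%:R *+ 2 - 1) * n%:R - n%:R * n.+1%:R) *: (alt (delta N) * wtr A).
Proof.
move=> Acomm; set T := wtr A.
pose U a b := wtr (Emx n b a *m Emx n a b *m A).
have UE a b : 'X_a * U a b = 'X_b * U b a.
  rewrite /U -mulmxA wtr_Emx -!mulmxA; congr (_ * wtr (_ *m _)).
  exact/esym/Acomm.
have Eaa a : wtr (Emx n a a *m A) = theta a T by rewrite (Acomm a a) wtr_Emx_diag.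
have UB a b : U a b - U b a = theta b T - theta a T.
  rewrite -!Eaa -!linearB /= -!mulmxBl; congr (wtr (_ *m _)).
  by rewrite EmxEmx !eqxx !scale1r; apply/eqP; rewrite subr_eq -addrA addrC.
have Ufreud a b : a != b -> ('X_a - 'X_b) * U a b = 'X_b * (theta a T - theta b T).
  by move=> _; rewrite mulrBl UE -mulrBr UB.
have Udiag a : U a a = theta a (theta a T).
  by rewrite /U -mulmxA (Acomm a a) mulmxA (Acomm a a) !wtr_Emx_diag.
have := freudenthal (theta_wtr A) Udiag Ufreud; rewrite -/T => F.
rewrite /casmx mulmxDl mul_scalar_mx linearD linearZ /= -/T mulrDr.
have -> : wtr (omega N n *m A) = \sum_a \sum_b U a b.
  rewrite /omega mulmx_suml linear_sum; apply: eq_bigr => a _.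
  by rewrite mulmx_suml linear_sum.
rewrite {}F -scalerAr addrCA -scalerBl; congr (_ + _).
by rewrite -scaleNr; congr (_ *: _); ring.
Qed.

Lemma casmx_commutes n k : commutes_gl (casmx N n ^+ k).
Proof. by move=> c d; exact/(@commrX _ (Emx n c d))/Emx_casmx_comm. Qed.

Lemma sufmx_commutes n k : commutes_gl (sufmx N n ^+ k).
Proof. by move=> c d; exact/(@commrX _ (Emx n c d))/Emx_sufmx_comm. Qed.

Lemma alt_delta_casimir n g : crystal_invariant g ->
  alt (delta N) * gensum N n (fun w => casimir w * g w) =
  lap (alt (delta N) * gensum N n g)
  - (sqdelta N + (N%:R *+ 2 - 1) * n%:R - n%:R * n.+1%:R) *: (alt (delta N) * gensum N n g).
Proof.
move=> ginv; rewrite (@eq_gensum _ _ _ (fun w => dbl_diag w * g w + (n%:R * n.+1%:R) * g w)).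
  rewrite gensumD gensumZ mulrDr alt_delta_diag // -scalerAr -addrA -scaleNr -scalerDl -scaleNr.
  by congr (_ + _ *: _); ring.
by move=> w /size_words wn; rewrite /casimir wn natrM mulrDl.
Qed.

Lemma wtr_casmx_gensum n (A : 'M[rat]_(dimw N n)) g :
  commutes_gl A -> crystal_invariant g -> wtr A = gensum N n g ->
  wtr (casmx N n *m A) = gensum N n (fun w => casimir w * g w).
Proof.
move=> Acomm ginv Ag; apply: (mulfI (alt_delta_neq0 N)).
by rewrite wtr_casmx // alt_delta_casimir // Ag.
Qed.

Lemma Smx_sufmxX n (a : 'I_N) s :
  Smx n a *m sufmx N n.+1 ^+ s = sufmx N n ^+ s *m Smx n a.
Proof.
elim: s => [|s IHs]; first by rewrite !expr0 mulmx1 mul1mx.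
by rewrite !exprS -![_ * _]/(_ *m _) mulmxA Smx_sufmx -!mulmxA IHs.
Qed.

(** Cyclicity brings [Smx] to the front; it passes through the power of [sufmx] at the cost of one
    unit of length, and then meets [Dmx]. The resulting recursion is that of [rsumS]. *)
Lemma wtr_DSmx s n (a : 'I_N) :
  (forall m, wtr (sufmx N m ^+ s) =
     gensum N m (fun w => casimir (even_ascent_suffix w) ^+ s)) ->
  wtr (sufmx N n ^+ s *m DSmx n a a) = rsum (fun v => casimir v ^+ s) n a.
Proof.
move=> IH; elim: n => [|n IHn]; first by rewrite mulmx0 linear0 rsum0.
rewrite rsumS -(IH n) mulmxA -wtr_Smx mulmxA Smx_sufmxX -mulmxA SmxDmx.
rewrite !mulmxDr !linearD /= IHn eqxx mul1r mul_mx_scalar linearZ /= wtr_Emx_diag.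
by rewrite addrA.
Qed.

(** One factor is split as [casmx - 2 r2r]. The first part inserts the weight [casimir w]; the
    second, by the recursion, removes [casimir w] minus the value at the suffix. What is left is the
    value at the suffix. *)
Lemma wtr_sufmxX s n : wtr (sufmx N n ^+ s) =
  gensum N n (fun w => casimir (even_ascent_suffix w) ^+ s).
Proof.
elim: s n => [|s IHs] n.
  rewrite expr0 /wtr /gensum -sum_wd; apply: eq_bigr => i _.
  by rewrite expr0 mxE eqxx.
pose g v := casimir v ^+ s.
have ginv : crystal_invariant g by move=> i w w' /casimir_crystal; rewrite /g => ->.
have R2 : wtr (r2r N n *m sufmx N n ^+ s) = \sum_a rsum g n a.
  have /commr_sym/(commrX s)/commr_sym RD : GRing.comm (sufmx N n) (r2r N n).
    apply/commr_sym/commrB; first exact: casmx_r2r_comm.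
    exact/commrMn/commr_refl.
  rewrite -[_ *m _]/(_ * _) -RD /r2r -[_ * _]/(_ *m _) mulmx_sumr linear_sum.
  by apply: eq_bigr => a _; rewrite /= wtr_DSmx.
rewrite exprS {1}/sufmx mulrBl linearB /= -[casmx N n * _]/(_ *m _).
rewrite (wtr_casmx_gensum (@sufmx_commutes n s) (suffix_crystal ginv) (IHs n)).
rewrite mulrnAl linearMn /= -[r2r N n * _]/(_ *m _) R2 -gensum_casimir // -gensumB.
by apply: eq_gensum => w _; rewrite /g exprS; ring.
Qed.

Lemma wtr_casmx_sufmx r s n : wtr (casmx N n ^+ r * sufmx N n ^+ s) =
  gensum N n (fun w => casimir w ^+ r * casimir (even_ascent_suffix w) ^+ s).
Proof.
elim: r => [|r IHr].
  by rewrite expr0 mul1r wtr_sufmxX; apply: eq_gensum => w _; rewrite expr0 mul1r.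
rewrite exprS -mulrA -[casmx N n * _]/(_ *m _).
rewrite (wtr_casmx_gensum _ _ IHr).
- by apply: eq_gensum => w _; rewrite exprS mulrA.
- move=> c d; apply: (@commrM _ (Emx n c d)); [exact: casmx_commutes | exact: sufmx_commutes].
move=> i w w' ww'; rewrite (casimir_crystal ww').
by have /(_ _ _ _ ww') -> := suffix_crystal casimir_crystal.
Qed.

Lemma scalemxX n k (A : 'M[rat]_n) q : (k *: A) ^+ q = k ^+ q *: A ^+ q.
Proof.
elim: q => [|q IHq]; first by rewrite !expr0 scale1r.
by rewrite !exprS IHq -[LHS]/(_ *m _) -scalemxAl -scalemxAr scalerA.
Qed.

(** The binomial expansion of [(casmx - sufmx) / 2], legitimate as the two commute, is matched term
    by term with that of the numbers. *)
Lemma wtr_r2rX q n : wtr (r2r N n ^+ q) =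
  gensum N n (fun w => ((casimir w - casimir (even_ascent_suffix w)) / 2) ^+ q).
Proof.
have -> : r2r N n = 2^-1 *: (casmx N n - sufmx N n).
  by rewrite /sufmx opprB addrC subrK -scaler_nat scalerA mulVf ?scale1r.
rewrite scalemxX linearZ /= exprBn_comm; last exact: casmx_sufmx_comm.
rewrite [wtr _]linear_sum scaler_sumr.
have -> : gensum N n (fun w => ((casimir w - casimir (even_ascent_suffix w)) / 2) ^+ q) =
  \sum_(i < q.+1) gensum N n (fun w => (2^-1 ^+ q * ((-1) ^+ i *+ 'C(q, i))) *
    (casimir w ^+ (q - i) * casimir (even_ascent_suffix w) ^+ i)).
  rewrite /gensum exchange_big; apply: eq_bigr => w _; rewrite -scaler_suml; congr (_ *: _).
  rewrite exprMn exprBn mulr_suml; apply: eq_bigr => i _.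
  rewrite -[(-1) ^+ i *+ _]mulr_natr -[X in X * _ = _]mulr_natr.
  rewrite -!mulrA [RHS]mulrCA; congr (_ * _).
  by rewrite [RHS]mulrA [RHS]mulrC -!mulrA; congr (_ * (_ * _)); rewrite mulrC.
apply: eq_bigr => i _; rewrite gensumZ -wtr_casmx_sufmx linearMn /= -mulrA.
have -> : (-1) ^+ i * (casmx N n ^+ (q - i) * sufmx N n ^+ i) =
    (-1) ^+ i *: (casmx N n ^+ (q - i) * sufmx N n ^+ i).
  by rewrite -[in LHS]signr_odd -[in RHS]signr_odd; case: (odd i); rewrite ?expr1 ?expr0 ?mulN1r ?scaleN1r ?mul1r ?scale1r.
by rewrite linearZ /= -scalerA scalerMnl.
Qed.
End Traces.

(** * Characteristic polynomials *)

Lemma tr_horner_mx m (M : 'M[rat]_m.+1) (I : finType) (e : I -> rat) (p : {poly rat}) :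
  (forall q, \tr (M ^+ q) = \sum_i e i ^+ q) ->
  \tr (horner_mx M p) = \sum_i p.[e i].
Proof.
move=> trM; rewrite -[p]coefK poly_def !linear_sum /=.
under [RHS]eq_bigr => i _ do rewrite horner_sum.
rewrite [RHS]exchange_big; apply: eq_bigr => k _ /=.
rewrite !linearZ /= rmorphXn /= horner_mx_X trM mulr_sumr.
by apply: eq_bigr => i _; rewrite hornerZ hornerXn.
Qed.

Lemma horner_prod_XsubC_eq0 (s : seq rat) x :
  ((\prod_(y <- s) ('X - y%:P)).[x] == 0) = (x \in s).
Proof. by rewrite -[_ == 0]/(root _ x) root_prod_XsubC. Qed.

(** A polynomial vanishing at all the values except [x] isolates the multiplicity of [x] on both
    sides. *)
Lemma perm_of_power_sums (I J : finType) (d : I -> rat) (e : J -> rat) :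
  (forall p : {poly rat}, \sum_i p.[d i] = \sum_j p.[e j]) ->
  perm_eq [seq d i | i <- enum I] [seq e j | j <- enum J].
Proof.
move=> pde; apply/allP=> x _ /=.
set s := rem x (undup ([seq d i | i <- enum I] ++ [seq e j | j <- enum J])).
pose p := \prod_(y <- s) ('X - y%:P).
have px : p.[x] != 0.
  by rewrite horner_prod_XsubC_eq0 mem_rem_uniq ?undup_uniq // inE eqxx.
have p0 y : y \in [seq d i | i <- enum I] ++ [seq e j | j <- enum J] -> y != x -> p.[y] = 0.
  move=> ys yx; apply/eqP; rewrite horner_prod_XsubC_eq0 mem_rem_uniq ?undup_uniq // inE.
  by rewrite mem_undup ys; apply/andP.
have sumE (K : finType) (f : K -> rat) :
    (forall k, f k \in [seq d i | i <- enum I] ++ [seq e j | j <- enum J]) ->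
    \sum_k p.[f k] = (count_mem x [seq f k | k <- enum K])%:R * p.[x].
  move=> fs; rewrite count_map mulr_natl.
  transitivity (\sum_(k | f k == x) p.[x]).
    rewrite [RHS]big_mkcond; apply: eq_bigr => k _ /=.
    by case: eqP => [->|/eqP kx] //; rewrite p0.
  by rewrite sumr_const; congr (_ *+ _); rewrite -sum1_card -sum1_count big_enum_cond.
have := pde p; rewrite !sumE.
- by move/(mulIf px)/eqP; rewrite eqr_nat.
- by move=> j; rewrite mem_cat map_f ?orbT // mem_enum.
- by move=> i; rewrite mem_cat map_f // mem_enum.
Qed.

Lemma char_poly_simmx m (P A D : 'M[rat]_m) :
  P \in unitmx -> P *m A = D *m P -> char_poly A = char_poly D.
Proof.
move=> Pu PA; have P0 : (\det P)%:P != 0 by rewrite polyC_eq0 -unitfE -unitmxE.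
apply: (mulfI P0); rewrite /char_poly [RHS]mulrC -det_map_mx -!det_mulmx; congr (\det _).
by rewrite /char_poly_mx mulmxBr mulmxBl -scalar_mxC -!map_mxM PA.
Qed.

(* [M] is symmetric, so the trace of [p(M) ^ 2] is a sum of squares; it vanishes for
   [p] with all the [e i] as roots, which makes [M] diagonalizable. *)
Lemma char_poly_of_traces m (M : 'M[rat]_m) (I : finType) (e : I -> rat) :
  #|I| = m -> M^T = M -> (forall q, \tr (M ^+ q) = \sum_i e i ^+ q) ->
  char_poly M = \prod_i ('X - (e i)%:P).
Proof.
case: m M => [|m] M cardI symM trM.
  rewrite /char_poly det_mx00 big1 // => i; have := max_card (pred1 i).
  by rewrite card1 cardI.
pose s := undup [seq e i | i <- enum I]; pose p := \prod_(y <- s) ('X - y%:P).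
have pM0 : horner_mx M p = 0.
  set Z := horner_mx M p.
  have symZ : Z^T = Z.
    rewrite /Z -[p]coefK poly_def !linear_sum; apply: eq_bigr => k _ /=.
    rewrite !linearZ /= rmorphXn /= horner_mx_X; congr (_ *: _).
    elim: (nat_of_ord k) => [|q IHq]; first by rewrite !expr0 trmx1.
    by rewrite exprS -mulmxE trmx_mul IHq symM mulmxE -exprSr exprS.
  have : \tr (Z *m Z) = 0.
    rewrite mulmxE -rmorphM (tr_horner_mx _ trM) big1 // => i _.
    rewrite hornerM; suff /eqP -> : p.[e i] == 0 by rewrite mulr0.
    by rewrite horner_prod_XsubC_eq0 mem_undup map_f // mem_enum.
  have trE : \tr (Z *m Z) = \sum_i \sum_j Z i j ^+ 2.
    apply: eq_bigr => i _; rewrite mxE; apply: eq_bigr => j _.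
    by rewrite -{2}symZ mxE expr2.
  rewrite trE => /eqP; rewrite psumr_eq0; last by move=> i _; apply: sumr_ge0 => j _; exact: sqr_ge0.
  move=> /allP Z0; apply/matrixP=> i j; rewrite mxE.
  have := Z0 i (mem_index_enum _); rewrite /= psumr_eq0; last by move=> k _; exact: sqr_ge0.
  by move=> /allP/(_ j (mem_index_enum _)); rewrite /= sqrf_eq0 => /eqP.
have [|P Pu /mxpoly.diagonalizable_forPex[d /(mxpoly.simmxP Pu) PM]] :=
  (mxpoly.diagonalizableP M).2.
  by exists s; [exact: undup_uniq | exact: mxminpoly_min].
rewrite (char_poly_simmx Pu PM) char_poly_trig ?diag_mx_is_trig //.
have trd q : \tr (M ^+ q) = \sum_i d 0 i ^+ q.
  have PMq : P *m M ^+ q = diag_mx (\row_i d 0 i ^+ q) *m P.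
    elim: q => [|q IHq].
      rewrite expr0 mulmx1; have -> : \row_i d 0 i ^+ 0 = const_mx 1 :> 'rV_m.+1.
        by apply/rowP=> i; rewrite !mxE expr0.
      by rewrite diag_const_mx mul1mx.
    rewrite exprSr -mulmxE mulmxA IHq -mulmxA PM mulmxA mulmx_diag; congr (diag_mx _ *m _).
    by apply/rowP=> i; rewrite !mxE exprSr.
  have -> : M ^+ q = invmx P *m (diag_mx (\row_i d 0 i ^+ q) *m P) by rewrite -PMq mulKmx.
  rewrite mxtrace_mulC -mulmxA mulmxV // mulmx1 mxtrace_diag.
  by apply: eq_bigr => i _; rewrite mxE.
have de : perm_eq [seq d 0 i | i <- enum 'I_m.+1] [seq e i | i <- enum I].
  by apply: perm_of_power_sums => q; rewrite -(tr_horner_mx _ trd) (tr_horner_mx _ trM).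
transitivity (\prod_(x <- [seq d 0 i | i <- enum 'I_m.+1]) ('X - x%:P)).
  by rewrite big_map big_enum; apply: eq_bigr => i _; rewrite mxE eqxx mulr1n.
by rewrite (perm_big _ de) big_map big_enum.
Qed.

(** * Restriction to the words of one evaluation *)

Section Transfer.
Variables (N n : nat) (nu : seq nat).
Local Notation wrd := (word N n nu).
Arguments words : simpl never.

Definition nu_content : {ffun 'I_N -> nat} := [ffun a : 'I_N => nth 0%N nu a].

Lemma letters_words (u : wrd) : letters u \in words N n.
Proof.
rewrite mem_words size_map size_tuple eqxx /=; apply/allP=> x /mapP[a _ ->] /=.
exact: ltn_ord.
Qed.

Lemma count_val (s : seq 'I_N) (a : 'I_N) : count_mem (a : nat) (map val s) = count_mem a s.
Proof. by rewrite count_map; apply: eq_count => b /=. Qed.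

Lemma content_letters (u : wrd) : content N (letters u) = nu_content.
Proof.
apply/ffunP=> a; rewrite !ffunE [LHS]count_val.
by have /forallP/(_ a)/eqP := valP u.
Qed.

Lemma letters_inj : injective (@letters N n nu).
Proof. by move=> u v /(inj_map val_inj)/val_inj/val_inj. Qed.

Lemma letters_surj w : w \in words N n -> content N w = nu_content ->
  exists u : wrd, letters u = w.
Proof.
rewrite mem_words => /andP[szw wN] cw.
have [s sw] : exists s : seq 'I_N, map val s = w.
  elim: w wN {szw cw} => [|x w IHw] /=; first by exists [::].
  by case/andP=> xN /IHw[s <-]; exists (Ordinal xN :: s).
have szs : size s == n by rewrite -(size_map val) sw.
have ev : has_evaluation nu (Tuple szs).
  apply/forallP=> a; rewrite -count_val /= sw.
  by have /ffunP/(_ a) := cw; rewrite !ffunE => ->.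
by exists (exist _ (Tuple szs) ev).
Qed.

Fact letters_index (u : wrd) : (index (letters u) (words N n) < dimw N n)%N.
Proof. by rewrite index_mem letters_words. Qed.

Definition windex (k : 'I_#|{: wrd}|) : 'I_(dimw N n) :=
  Ordinal (letters_index (enum_val k)).

Lemma wd_windex k : wd (windex k) = letters (enum_val k).
Proof. by rewrite /wd /= nth_index ?letters_words. Qed.

Lemma windex_inj : injective windex.
Proof.
by move=> k l /(congr1 (@wd N n)); rewrite !wd_windex => /letters_inj/enum_val_inj.
Qed.

Lemma sum_windex (V : nmodType) (F : 'I_(dimw N n) -> V) :
  (forall l, content N (wd l) != nu_content -> F l = 0) ->
  \sum_l F l = \sum_k F (windex k).
Proof.
move=> F0; rewrite -(big_map windex xpredT F) /= (bigID (fun l => content N (wd l) == nu_content)) /=.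
rewrite [X in _ + X]big1 // addr0 -big_filter; apply: perm_big.
apply: uniq_perm; first by rewrite filter_uniq ?index_enum_uniq.
  by rewrite (map_inj_uniq windex_inj) index_enum_uniq.
move=> l; rewrite mem_filter mem_index_enum andbT; apply/eqP/mapP => [lnu|[k _ ->]].
  have [u uE] := letters_surj (wd_in l) lnu.
  exists (enum_rank u); rewrite ?mem_index_enum //.
  by apply: (@wd_inj N n); rewrite wd_windex enum_rankK.
by rewrite wd_windex content_letters.
Qed.

Lemma perm_ins a w v : v \in ins a w -> perm_eq v (a :: w).
Proof.
elim: w v => [|c w IHw] v /=; first by rewrite inE => /eqP ->.
rewrite inE => /predU1P[-> //|/mapP[u /IHw uw ->]].
rewrite -(perm_cons c) in uw; apply: perm_trans uw _.
exact/permEl/(perm_catCA [:: c] [:: a]).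
Qed.

Lemma perm_del b w v : v \in del b w -> perm_eq (b :: v) w.
Proof.
elim: w v => [|c w IHw] v //=; rewrite mem_cat => /orP[|/mapP[u /IHw uw ->]].
  by case: eqP => // ->; rewrite inE => /eqP ->.
rewrite -(perm_cons c) in uw; apply: perm_trans uw.
exact/permEl/(perm_catCA [:: b] [:: c]).
Qed.

Lemma r2r_content (i j : 'I_(dimw N n)) : r2r N n i j != 0 ->
  content N (wd i) = content N (wd j).
Proof.
move=> r0; apply/eqP; apply: contraNT r0 => cij; rewrite /r2r summxE; apply/eqP.
apply: big1 => b _; rewrite DSmxE big_seq big1 // => v vi; rewrite big_seq big1 // => u uv.
case: eqP => // uj; case/negP: cij; apply/eqP/ffunP=> a; rewrite !ffunE -uj.
by apply/seq.permP; rewrite perm_sym (perm_trans (perm_ins uv)) ?perm_del.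
Qed.

Definition block : 'M[rat]_#|{: wrd}| := \matrix_(k, l) r2r N n (windex k) (windex l).

(** As [r2r] preserves contents, no intermediate word of a product leaves the block. *)
Lemma blockX q k l : (block ^+ q) k l = (r2r N n ^+ q) (windex k) (windex l).
Proof.
elim: q k l => [|q IHq] k l; first by rewrite !expr0 !mxE (inj_eq windex_inj).
rewrite !exprS -![_ * _]/(_ *m _) !mxE sum_windex.
  by apply: eq_bigr => m _; rewrite IHq mxE.
move=> m mnu; have [->|/r2r_content cm] := eqVneq (r2r N n (windex k) m) 0; first by rewrite mul0r.
by rewrite -cm wd_windex content_letters eqxx in mnu.
Qed.

Lemma casimir_eig w : (casimir w - casimir (even_ascent_suffix w)) / 2 = (eig w)%:~R.
Proof.
have binE m : ('C(m.+1, 2)%:Z)%:~R = (m * m.+1)%:R / 2 :> rat.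
  have := mul_bin_diag m.+1 1; rewrite bin1 /= => binE.
  by rewrite -pmulrn mulnC binE natrM mulrC mulKf.
have E s : ('C((size s).+1, 2)%:Z + diag (recording_tableau s))%:~R = casimir s / 2 :> rat.
  by rewrite intrD binE /casimir /dbl_diag intrD; field.
by rewrite /eig intrB !E mulrBl.
Qed.

(** The identity [wtr_r2rX] read at the coefficient of the monomial with exponents [nu]. *)
Lemma tr_blockX q : \tr (block ^+ q) = \sum_(u : wrd) (eig (letters u))%:~R ^+ q.
Proof.
have := congr1 (mcoeff [multinom nu_content a | a < N]) (wtr_r2rX N q n).
rewrite /wtr /gensum -(@sum_wd N _ n (fun w => _ *: mon (content N w))) !raddf_sum /=.
rewrite !sum_windex => [E||].
- transitivity (\sum_k (mcoeff [multinom nu_content a | a < N]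
     ((r2r N n ^+ q) (windex k) (windex k) *: mon (content N (wd (windex k)))))).
    apply: eq_bigr => k _; rewrite blockX mcoeffZ wd_windex content_letters mcoeffX eqxx.
    by rewrite mulr1.
  rewrite E [RHS](reindex (@enum_val _ {: wrd})) /=; last first.
    by exists enum_rank => ? _; rewrite (enum_valK, enum_rankK).
  apply: eq_bigr => k _; rewrite casimir_eig mcoeffZ wd_windex content_letters mcoeffX eqxx.
  by rewrite mulr1.
- move=> l lnu; rewrite mcoeffZ mcoeffX; case: eqP => [E|_]; last by rewrite mulr0.
  by case/eqP: lnu; apply/ffunP=> a; have /mnmP/(_ a) := E; rewrite !mnmE.
- move=> l lnu; rewrite mcoeffZ mcoeffX; case: eqP => [E|_]; last by rewrite mulr0.
  by case/eqP: lnu; apply/ffunP=> a; have /mnmP/(_ a) := E; rewrite !mnmE.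
Qed.

End Transfer.

(** * Moves of the shuffle by positions, their symmetry, and the characteristic polynomial *)

Lemma sum_ins_take b x (f : seq nat -> rat) :
  \sum_(y <- ins b x) f y = \sum_(j < (size x).+1) f (take j x ++ b :: drop j x).
Proof.
elim: x f => [|c x IHx] f; first by rewrite big_seq1 big_ord1.
by rewrite sum_ins IHx [RHS]big_ord_recl /= .
Qed.

Lemma sum_del_take N (g : nat -> seq nat -> rat) s : all (ltn^~ N) s ->
  \sum_(b < N) \sum_(x <- del b s) g b x =
  \sum_(i < size s) g (nth 0%N s i) (take i s ++ drop i.+1 s).
Proof.
elim: s g => [|c s IHs] g /=.
  by rewrite big_ord0 big1 // => b _; rewrite big_nil.
case/andP=> cN sN; rewrite big_ord_recl /= drop0 -(IHs (fun b x => g b (c :: x)) sN).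
transitivity (\sum_(b < N) ((c == b)%:R * g b s + \sum_(x <- del b s) g b (c :: x))).
  by apply: eq_bigr => b _; exact: (sum_del b c s (g b)).
rewrite big_split /=; congr (_ + _).
rewrite (bigD1 (Ordinal cN)) //= eqxx mul1r big1 ?addr0 // => b bc.
case: eqP => [cb|_]; last by rewrite mul0r.
by case/eqP: bc; apply: val_inj.
Qed.

(** A move is undone by the move with the two positions exchanged; this makes the transition matrix
    symmetric. *)
Lemma move_letterK s i j : (i < size s)%N -> (j < size s)%N ->
  move_letter (move_letter s i j) j i = s.
Proof.
move=> i_s j_s; rewrite /move_letter; set x := nth _ s i; set t := take i s ++ _.
have szt : (j <= size t)%N by rewrite size_cat size_take size_drop i_s; lia.
have szj : size (take j t) = j by rewrite size_takel.
have -> : nth 0%N (take j t ++ x :: drop j t) j = x by rewrite nth_cat szj ltnn subnn.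
have -> : take j (take j t ++ x :: drop j t) = take j t by rewrite take_cat szj ltnn subnn cats0.
have -> : drop j.+1 (take j t ++ x :: drop j t) = drop j t.
  by rewrite drop_cat szj ltnNge leqnSn subSn // subnn /= drop0.
have szi : size (take i s) = i by rewrite size_takel // ltnW.
rewrite cat_take_drop {1 2}/t take_cat drop_cat szi ltnn subnn take0 drop0 cats0.
by rewrite -(drop_nth 0%N i_s) cat_take_drop.
Qed.

Section Final.
Variables (N n : nat) (nu : seq nat).
Local Notation wrd := (word N n nu).

Definition move_count (u v : wrd) : nat :=
  #|[set ij : 'I_n * 'I_n | move_letter (letters u) ij.1 ij.2 == letters v]|.

Lemma size_letters (u : wrd) : size (letters u) = n.
Proof. by rewrite size_map size_tuple. Qed.

Lemma move_count_sym u v : move_count u v = move_count v u.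
Proof.
suff le (x y : wrd) : (move_count x y <= move_count y x)%N.
  by apply/eqP; rewrite eqn_leq !le.
pose swp (p : 'I_n * 'I_n) := (p.2, p.1).
have swp_inj : injective swp by move=> [i j] [k l] [-> ->].
pose S := [set ij : 'I_n * 'I_n | move_letter (letters x) ij.1 ij.2 == letters y].
have -> : move_count x y = #|swp @: S| by rewrite card_imset.
apply/subset_leq_card/subsetP=> _ /imsetP[[i j] + ->]; rewrite !inE /= => /eqP <-.
by rewrite move_letterK ?size_letters.
Qed.

Lemma block_move_count k l :
  block N n nu k l = (move_count (enum_val k) (enum_val l))%:R.
Proof.
rewrite mxE /r2r summxE; set s := letters (enum_val k); set t := letters (enum_val l).
transitivity (\sum_(b < N) \sum_(x <- del b s) \sum_(y <- ins b x) (y == t)%:R : rat).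
  by apply: eq_bigr => b _; rewrite DSmxE !wd_windex.
have := letters_words (enum_val k); rewrite mem_words => /andP[/eqP szs sN].
rewrite (sum_del_take (fun b x => \sum_(y <- ins b x) (y == t)%:R) sN).
rewrite /move_count -sum1_card natr_sum.
transitivity (\sum_(i < n) \sum_(j < n) (move_letter s i j == t)%:R : rat).
  rewrite -/s szs; apply: eq_bigr => i _; rewrite sum_ins_take.
  by rewrite size_cat size_take size_drop szs ltn_ord (_ : (i + (n - i.+1)).+1 = n) //;
    have := ltn_ord i; lia.
rewrite pair_big /= [RHS]big_mkcond; apply: eq_bigr => -[i j] _ /=.
by rewrite inE /=; case: eqP.
Qed.

Lemma char_poly_r2r (R : numFieldType) :
  char_poly (r2r_matrix R N n nu) =
  \prod_(u : wrd) ('X - ((eig (letters u))%:~R / n%:R ^+ 2)%:P).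
Proof.
(* The matrix has rational entries: the spectrum is found over the rationals, where
   [char_poly_of_traces] applies, and transported to [R]. *)
pose B : 'M[rat]_#|{: wrd}| := (n%:R ^+ 2)^-1 *: block N n nu.
have -> : r2r_matrix R N n nu = map_mx ratr B.
  apply/matrixP=> k l; rewrite [LHS]mxE [RHS]mxE [B k l]mxE block_move_count /r2r_prob -/(move_count _ _).
  by rewrite mulrC rmorphM fmorphV rmorphXn /= !ratr_nat.
rewrite -map_char_poly (@char_poly_of_traces _ B wrd
  (fun u => (eig (letters u))%:~R / n%:R ^+ 2)) //.
- rewrite map_prod_XsubC; apply: eq_bigr => u _.
  by congr ('X - _%:P); rewrite /= fmorph_div rmorphXn /= ratr_int ratr_nat.
- by apply/matrixP=> k l; rewrite mxE [LHS]mxE [RHS]mxE !block_move_count move_count_sym.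
move=> q; rewrite scalemxX mxtraceZ tr_blockX mulr_sumr; apply: eq_bigr => u _.
by rewrite exprMn mulrC.
Qed.

End Final.

Theorem theorem11 (R : numFieldType) (N n : nat) (nu : seq nat)
    (hnu : is_partition_of nu n) (hN : (size nu <= N)%N) :
  (forall w : word N n nu,
      eigenvalue (r2r_matrix R N n nu) ((eig (letters w))%:~R / n%:R ^+ 2)) /\
  (forall eps : R, eigenvalue (r2r_matrix R N n nu) eps ->
      mup eps (char_poly (r2r_matrix R N n nu)) =
      #|[set w : word N n nu | (eig (letters w))%:~R == n%:R ^+ 2 * eps]|).
Proof.
split=> [w|eps].
  rewrite eigenvalue_root_char char_poly_r2r (bigD1 w) //= rootM.
  by rewrite root_XsubC eqxx.
rewrite eigenvalue_root_char char_poly_r2r.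
rewrite -(big_map (fun u => _) xpredT (fun x => 'X - x%:P)) root_prod_XsubC.
move=> /mapP[u0 _ epsE]; rewrite mu_prod_XsubC count_map -sum1_card -sum1_count.
rewrite [in LHS]big_mkcond [in RHS]big_mkcond /=; apply: eq_bigr => w _; rewrite inE.
congr (if _ then _ else _).
(* For [n = 0], dividing by [n ^ 2] gives 0 by convention, which agrees with [eig] of the empty
   word. *)
have [n0|n_gt0] := posnP n.
  have eig0 (u : word N n nu) : eig (letters u) = 0.
    have -> : letters u = [::] by apply: size0nil; rewrite size_letters.
    exact: subrr.
  by rewrite epsE !eig0 !mul0r mulr0 !eqxx.
have n2 : n%:R ^+ 2 != 0 :> R by rewrite expf_neq0 // pnatr_eq0 -lt0n.
by rewrite -(inj_eq (mulIf n2)) divfK // mulrC.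
Qed.
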